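(* Let $\mathcal G$ be an infinite connected $d$-regular rooted Ramanujan graph, and let $(X_i)_{i\ge 0}$ be the standard random walk on $\mathcal G$ started at the root. Then for every integer $k\geq 1$ $$\lim_{n\to\infty}\frac{1}{n}\sum_{i=1}^n \mathbb E\bigl[C_{\mathcal G}(X_i,k)\bigr]=0.$$
   Context: Graphs are undirected and may have loops and multiple edges. For a countable $d$-regular graph $\mathcal G$, the spectral radius $\rho(\mathcal G)$ is the operator norm on $\ell^2(\mathcal G)$ of the averaging operator $Pf(v)=\frac1d\sum_{v'\sim v}f(v')$ (neighbours counted with multiplicity). An infinite $d$-regular graph $\mathcal G$ is called Ramanujan if $\rho(\mathcal G)=\rho(\mathbb T_d)$, where $\mathbb T_d$ is the $d$-regular tree; explicitly $\rho(\mathbb T_d)=2\sqrt{d-1}/d$ for $d\ge2$. The standard random walk moves at each step along a uniformly chosen one of the $d$ edges at the current vertex. For a vertex $x$ of $\mathcal G$ and $k\ge1$, $C_{\mathcal G}(x,k)=1$ if there exists a non-backtracking cycle of length $k$ starting at $x$, and $C_{\mathcal G}(x,k)=0$ otherwise. Here a non-backtracking cycle of length $k$ starting at $x$ is a closed walk with $k$ edges from $x$ to $x$ in which no edge is immediately followed by its own reversal (no condition is imposed between the last and first edges). *)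

(* Defs.v *)
From HB Require Import structures.
From mathcomp Require Import all_boot all_order all_algebra.
From mathcomp Require Import all_classical all_reals all_analysis.
Set Implicit Arguments.
Unset Strict Implicit.
Unset Printing Implicit Defensive.
Import Order.TTheory GRing.Theory Num.Theory.
Import numFieldNormedType.Exports.
Local Open Scope classical_set_scope.
Local Open Scope ring_scope.

(* Undirected multigraphs, encoded by oriented edges: an edge is an orbit
   {e, flip e}.  A loop is an orbit with src e = tgt e; it may consist of two
   orientations, and then contributes 2 to the degree, or of a single e with
   flip e = e, and then contributes 1.  Both conventions for loops in regular
   graphs are thereby covered. *)
Record multigraph := Multigraph {
  vertex : choiceType;
  edge : choiceType;
  src : edge -> vertex;
  flip : edge -> edge;
  flipK : involutive flip
}.

Section Graph.
Variable G : multigraph.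
Implicit Types (x y : vertex G) (e : edge G) (p : seq (edge G)).

Definition tgt e : vertex G := src (flip e).

Definition star x : set (edge G) := [set e | src e = x].

Definition regular_graph (d : nat) : Prop := forall x, (star x #= `I_d)%card.

Fixpoint walk x p y : Prop :=
  if p is e :: p' then src e = x /\ walk (tgt e) p' y else x = y.

Definition connected_graph : Prop := forall x y, exists p, walk x p y.

Definition nonbacktracking p : bool := sorted (fun e f => f != flip e) p.

Definition cycle_at x (k : nat) : Prop :=
  exists p, [/\ size p = k, walk x p x & nonbacktracking p].

Section Analytic.
Variable R : realType.

Definition cycle_indicator (k : nat) : vertex G -> R :=
  \1_[set x | cycle_at x k].

Definition averaging (d : nat) (f : vertex G -> R) (x : vertex G) : R :=
  d%:R^-1 * \sum_(e \in star x) f (tgt e).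

(* +oo when f is not square summable *)
Definition l2norm (f : vertex G -> R) : \bar R :=
  sqrte (\esum_(x in [set: vertex G]) ((f x) ^+ 2)%:E).

(* Operator norm of averaging on l^2; since this operator is real, the real
   and the complex l^2 spaces give the same value. *)
Definition spectral_radius (d : nat) : \bar R :=
  ereal_sup [set l2norm (averaging d f) | f in [set f | (l2norm f <= 1)%E]].

Definition step_prob (d : nat) x y : R :=
  \sum_(e \in [set e | src e = x /\ tgt e = y]) (d%:R^-1 : R).

(* The first clause says that each X_i is a discrete random variable: in a
   connected regular graph the vertex set is countable.  The last clause is the
   Markov property with kernel step_prob, on trajectories t 0, ..., t n.+1. *)
Definition standard_random_walk (d : nat) (o : vertex G)
    (disp : measure_display) (Omega : measurableType disp)
    (P : probability Omega R) (X : nat -> Omega -> vertex G) : Prop :=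
  [/\ forall i v, measurable [set w | X i w = v],
      P [set w | X 0%N w = o] = 1%E
    & forall (n : nat) (t : nat -> vertex G),
      P [set w | forall i, (i <= n.+1)%N -> X i w = t i] =
      (P [set w | forall i, (i <= n)%N -> X i w = t i] *
       (step_prob d (t n) (t n.+1))%:E)%E].

End Analytic.
End Graph.

Arguments spectral_radius G R d : clear implicits.

(* The d-regular tree, as the Cayley graph of the free product of d copies of
   Z/2: vertices are reduced words, stored with the last letter first, and
   the edge (w, i) goes from w to the reduced form of w followed by i. *)
Section RegularTree.
Variable d : nat.

Definition reduced (w : seq 'I_d) : bool := sorted (fun i j => i != j) w.

Definition append_letter (w : seq 'I_d) (i : 'I_d) : seq 'I_d :=
  if w is j :: w' then if i == j then w' else i :: w else [:: i].

Lemma append_letter_reduced w i : reduced w -> reduced (append_letter w i).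
Proof.
case: w => [|j w] //= rw; case: ifP => [_|/negbT ij]; first exact: path_sorted rw.
by rewrite /reduced /= ij.
Qed.

Definition tree_vertex := {w : seq 'I_d | reduced w}.

Definition tree_step (w : tree_vertex) (i : 'I_d) : tree_vertex :=
  Sub (append_letter (val w) i) (append_letter_reduced i (valP w)).

Definition tree_src (e : tree_vertex * 'I_d) : tree_vertex := e.1.

Definition tree_flip (e : tree_vertex * 'I_d) : tree_vertex * 'I_d :=
  (tree_step e.1 e.2, e.2).

Lemma tree_flipK : involutive tree_flip.
Proof.
case=> -[w rw] i; congr pair; apply/val_inj => /=.
case: w rw => [|j w] /= rw; first by rewrite eqxx.
case: eqVneq => [->|ij] /=; last by rewrite eqxx.
by case: w rw => [|k w] //= /andP[/negbTE ->].
Qed.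

Definition regular_tree : multigraph := Multigraph tree_src tree_flipK.

End RegularTree.

Definition ramanujan (R : realType) (d : nat) (G : multigraph) : Prop :=
  spectral_radius G R d = spectral_radius (regular_tree d) R d.

(* Main.v *)
Require Import Defs.
From HB Require Import structures.
From mathcomp Require Import all_boot all_order all_algebra.
From mathcomp Require Import all_classical all_reals all_analysis.
From mathcomp Require Import finmap ring lra zify.
Set Implicit Arguments.
Unset Strict Implicit.
Unset Printing Implicit Defensive.
Import Order.TTheory GRing.Theory Num.Theory.
Import numFieldNormedType.Exports.
Local Open Scope classical_set_scope.
Local Open Scope ring_scope.

(* Let q = d - 1, let A be the adjacency operator and assume q >= 2.  Since
   ||A|| <= 2 sqrt q, for every a > 2 sqrt q the function
   h = sum_m a^-m A^m delta_o is positive with A h <= a h.  Lift h to the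
   universal cover T, a d-regular tree, and compare it with the critical
   function phi(v) = q^(-|v|/2) of T cut off at radius N.  As a decreases to
   2 sqrt q, the ground-state identity bounds
     sum over v and over walks of length m from v to w of
       h(v) h(w) (phi(v)/h(v) - phi(w)/h(w))^2
   by a constant independent of N.  If a non-backtracking cycle of length k
   sits at the image of v, its lift leads from v to a vertex v' with
   h(v') = h(v), so the corresponding term is (phi(v) - phi(v'))^2; lifting
   the cycle once or twice changes the distance to the root, so that one of
   the two terms is at least a constant times q^-|v|.  Hence the sum of q^-|v|
   over the vertices v of T lying over k-cycles is finite.  The Green function
   of the simple random walk on T is bounded by 2 q^-|v|, so the expected total
   number of visits of the walk to k-cycles is finite.

   For d <= 2 only finitely many vertices carry a k-cycle, and a maximum
   principle shows that the walk on an infinite graph spends a vanishing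
   proportion of its time at any given vertex. *)

(** * Neighbour sums *)

Section NeighbourSum.
Variables (R : realType) (X : Type) (N : X -> seq X).
Implicit Types (f g : X -> R) (m : nat).

Definition nsum f x : R := \sum_(y <- N x) f y.

Lemma nsumD f g : nsum (f \+ g) = nsum f \+ nsum g.
Proof. by apply/funext => x; rewrite /nsum big_split. Qed.

Lemma nsumZ a f : nsum (fun x => a * f x) = fun x => a * nsum f x.
Proof. by apply/funext => x; rewrite /nsum mulr_sumr. Qed.

Lemma iter_nsumD m f g :
  iter m nsum (f \+ g) = iter m nsum f \+ iter m nsum g.
Proof. by elim: m => //= m ->; rewrite nsumD. Qed.

Lemma iter_nsumZ m a f :
  iter m nsum (fun x => a * f x) = fun x => a * iter m nsum f x.
Proof. by elim: m => //= m ->; rewrite nsumZ. Qed.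

Lemma iter_nsum_sum m (I : Type) (s : seq I) (F : I -> X -> R) :
  iter m nsum (fun x => \sum_(i <- s) F i x)
  = fun x => \sum_(i <- s) iter m nsum (F i) x.
Proof.
elim: m => //= m ->; apply/funext => x.
by rewrite /nsum exchange_big.
Qed.

Lemma nsum_ge0 f : (forall x, 0 <= f x) -> forall x, 0 <= nsum f x.
Proof. by move=> f0 x; apply: sumr_ge0. Qed.

Lemma iter_nsum_ge0 m f :
  (forall x, 0 <= f x) -> forall x, 0 <= iter m nsum f x.
Proof. by move=> f0; elim: m => //= m IH; apply: nsum_ge0. Qed.

Lemma ler_nsum f g : (forall x, f x <= g x) -> forall x, nsum f x <= nsum g x.
Proof. by move=> fg x; apply: ler_sum. Qed.

Lemma ler_iter_nsum m f g :
  (forall x, f x <= g x) -> forall x, iter m nsum f x <= iter m nsum g x.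
Proof. by move=> fg; elim: m => //= m IH; apply: ler_nsum. Qed.

Lemma iter_nsum_super (a : R) m f : 0 <= a ->
  (forall x, nsum f x <= a * f x) -> forall x, iter m nsum f x <= a ^+ m * f x.
Proof.
move=> a0 fa; elim: m => [|m IH] x; first by rewrite mul1r.
rewrite iterSr; apply: le_trans (ler_iter_nsum m fa x) _.
by rewrite iter_nsumZ exprS -mulrA ler_wpM2l.
Qed.

End NeighbourSum.

Lemma le_nsum_mem (R : realType) (X : eqType) (N : X -> seq X) (f : X -> R) x y :
  (forall z, 0 <= f z) -> y \in N x -> f y <= nsum N f x.
Proof.
move=> f0 yx; rewrite /nsum (perm_big _ (perm_to_rem yx)) big_cons lerDl.
exact: sumr_ge0.
Qed.

Section Regular.
Variables (R : realType) (G : multigraph) (d : nat).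
Hypothesis Greg : regular_graph G d.
Implicit Types (x y : vertex G) (e : edge G) (p : seq (edge G)).

Definition out_edges x : seq (edge G) := fset_set (star x).

Lemma finite_star x : finite_set (star x).
Proof. by exists d; apply: Greg. Qed.

Lemma mem_out_edges x e : (e \in out_edges x) = (src e == x).
Proof.
rewrite /out_edges in_fset_set; last exact: finite_star.
by apply/idP/eqP => [/set_mem|ex] //; apply: mem_set.
Qed.

Lemma out_edges_uniq x : uniq (out_edges x).
Proof. exact: fset_uniq. Qed.

Lemma size_out_edges x : size (out_edges x) = d.
Proof. exact: card_fset_set (Greg x). Qed.

Definition neighbours x := [seq tgt e | e <- out_edges x].

Lemma nsum_neighbours (f : vertex G -> R) x :
  nsum neighbours f x = \sum_(e <- out_edges x) f (tgt e).
Proof. by rewrite /nsum big_map. Qed.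

Lemma mem_neighbours e : tgt e \in neighbours (src e).
Proof. by apply: map_f; rewrite mem_out_edges. Qed.

Lemma averagingE (f : vertex G -> R) x :
  averaging d f x = d%:R^-1 * nsum neighbours f x.
Proof.
by rewrite /averaging nsum_neighbours fsbig_finite //; exact: finite_star.
Qed.

Lemma iter_nsum_walk m (f : vertex G -> R) x p y : (forall z, 0 <= f z) ->
  size p = m -> walk x p y -> f y <= iter m (nsum neighbours) f x.
Proof.
move=> f0; elim: m x p => [|m IH] x [|e p] //=; first by move=> _ ->.
case=> sp [ex wp]; apply: le_trans (IH _ _ sp wp) _.
apply: le_nsum_mem; first exact: iter_nsum_ge0.
by rewrite -ex mem_neighbours.
Qed.

End Regular.
Arguments out_edges {G}.
Arguments neighbours {G}.

(** * The universal cover *)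

Section Cover.
Variables (R : realType) (G : multigraph) (d : nat).
Hypothesis Greg : regular_graph G d.
Variable o : vertex G.
Implicit Types (x y : vertex G) (e : edge G) (p v w : seq (edge G)).
Implicit Types (F H : seq (edge G) -> R).

(* The universal cover: its vertices are the reduced walks from [o], stored
   with the last edge first. *)
Definition endpoint v : vertex G := if v is e :: _ then tgt e else o.

Fixpoint is_walk v : Prop :=
  if v is e :: v' then src e = endpoint v' /\ is_walk v' else True.

Definition extends v e : bool := if v is f :: _ then e != flip f else true.

Definition children v : seq (seq (edge G)) :=
  [seq e :: v | e <- out_edges (endpoint v) & extends v e].

Definition cover_nbrs v : seq (seq (edge G)) :=
  (if v is _ :: v' then [:: v'] else [::]) ++ children v.

Fixpoint level n : seq (seq (edge G)) :=
  if n is n'.+1 then flatten [seq children v | v <- level n'] else [:: [::]].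

(** Lifting of edges to the cover: [foldl step v p] is the end of the lift of the walk [p] from
    [v]. *)
Definition step v e : seq (edge G) :=
  if v is f :: v' then (if e == flip f then v' else e :: v) else [:: e].

Notation covA := (nsum (R := R) cover_nbrs).
Notation grA := (nsum (R := R) (neighbours (G := G))).

Lemma in_children v w : w \in children v ->
  exists e, [/\ w = e :: v, src e = endpoint v & extends v e].
Proof.
case/mapP => e; rewrite mem_filter => /andP[ve].
by rewrite (mem_out_edges Greg) => /eqP se ->; exists e.
Qed.

Lemma level_is_walk n v : v \in level n -> is_walk v.
Proof.
elim: n v => [|n IH] v /=; first by rewrite mem_seq1 => /eqP ->.
by case/flattenP => _ /mapP[u ul ->] /in_children[e [-> se _]]; split=> //; exact: IH.
Qed.

Lemma size_level n v : v \in level n -> size v = n.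
Proof.
elim: n v => [|n IH] v /=; first by rewrite mem_seq1 => /eqP ->.
by case/flattenP => _ /mapP[u ul ->] /in_children[e [-> _ _]] /=; rewrite (IH u).
Qed.

Lemma sum_levelS n F :
  \sum_(w <- level n.+1) F w
  = \sum_(v <- level n) \sum_(w <- children v) F w.
Proof. by rewrite /= big_flatten big_map. Qed.

Lemma covA_nil F : covA F [::] = \sum_(w <- children [::]) F w.
Proof. by []. Qed.

Lemma covA_cons F f v :
  covA F (f :: v) = F v + \sum_(w <- children (f :: v)) F w.
Proof. by rewrite /nsum big_cons. Qed.

Lemma perm_out_edges_cons f v :
  perm_eq (out_edges (tgt f)) (flip f :: [seq e <- out_edges (tgt f) | extends (f :: v) e]).
Proof.
have ff : flip f \in out_edges (tgt f) by rewrite (mem_out_edges Greg).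
by rewrite (perm_trans (perm_to_rem ff)) // rem_filter ?out_edges_uniq.
Qed.

Lemma size_children_cons f v : size (children (f :: v)) = d.-1.
Proof.
rewrite size_map -[d](size_out_edges Greg (tgt f)).
by rewrite (perm_size (perm_out_edges_cons f v)).
Qed.

Lemma size_children_nil : size (children [::]) = d.
Proof.
rewrite size_map (_ : [seq e <- _ | _] = out_edges o) ?(size_out_edges Greg) //.
exact: filter_predT.
Qed.

Lemma size_level1 : size (level 1) = d.
Proof. by rewrite /= cats0 size_children_nil. Qed.

Lemma sum_level_const n (a : R) :
  \sum_(v <- level n.+1) a = d%:R * (d.-1)%:R ^+ n * a.
Proof.
elim: n => [|n IH].
  by rewrite big_const_seq count_predT size_level1 iter_addr addr0 expr0 mulr1 mulr_natl.
rewrite sum_levelS (eq_big_seq (fun=> d.-1%:R * a)).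
  by rewrite -mulr_sumr IH exprS; ring.
move=> v /size_level; case: v => // f v _.
by rewrite big_const_seq count_predT size_children_cons iter_addr addr0 mulr_natl.
Qed.

(** [endpoint] is a covering map: it matches the neighbours of [v] with those of its endpoint,
    multiplicities included. *)
Lemma covA_endpoint (h : vertex G -> R) v : is_walk v ->
  covA (h \o endpoint) v = grA h (endpoint v).
Proof.
rewrite nsum_neighbours; case: v => [|f v] /=.
  move=> _; rewrite covA_nil /children big_map /= (_ : [seq e <- _ | _] = out_edges o) //.
  exact: filter_predT.
case=> fv _; rewrite covA_cons big_map (perm_big _ (perm_out_edges_cons f v)) big_cons /=.
by rewrite -fv /tgt flipK.
Qed.

Lemma cover_nbrs_is_walk v w : is_walk v -> w \in cover_nbrs v -> is_walk w.
Proof.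
rewrite mem_cat => wv /orP[|/in_children[e [-> se _]]]; last by split.
by case: v wv => // f v [_ wv]; rewrite mem_seq1 => /eqP ->.
Qed.

Lemma iter_covA_endpoint m (h : vertex G -> R) v : is_walk v ->
  iter m covA (h \o endpoint) v = iter m grA h (endpoint v).
Proof.
elim: m v => //= m IH v wv; rewrite -covA_endpoint // /nsum.
by apply: eq_big_seq => w wvn; rewrite IH //; exact: cover_nbrs_is_walk wvn.
Qed.

Lemma step_cover_nbrs v e :
  src e = endpoint v -> step v e \in cover_nbrs v.
Proof.
move=> ev; rewrite mem_cat; case: v ev => [|f v] ev.
  by rewrite (map_f (cons^~ [::])) // mem_filter (mem_out_edges Greg) ev eqxx.
rewrite /step; case: ifP => [_|/negbT ef]; first by rewrite mem_seq1 eqxx.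
rewrite (map_f (cons^~ (f :: v))) ?orbT // mem_filter (mem_out_edges Greg) ev eqxx.
by rewrite /= ef.
Qed.

Lemma step_endpoint v e : src e = endpoint v -> is_walk v ->
  endpoint (step v e) = tgt e.
Proof.
by case: v => [//|f v] /= ef [fv _]; case: eqP => // ->; rewrite /tgt flipK.
Qed.

Lemma steps_walk v p y : is_walk v -> walk (endpoint v) p y ->
  is_walk (foldl step v p) /\ endpoint (foldl step v p) = y.
Proof.
elim: p v => [|e p IH] v wv //= [ev wp].
have ws := cover_nbrs_is_walk wv (step_cover_nbrs ev).
by apply: IH => //; rewrite step_endpoint.
Qed.

Lemma iter_covA_steps m (K : seq (edge G) -> R) v p y :
  (forall w, 0 <= K w) -> size p = m -> is_walk v -> walk (endpoint v) p y ->
  K (foldl step v p) <= iter m covA K v.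
Proof.
move=> K0; elim: m v p => [|m IH] v [|e p] //= sp wv; case=> ev wp.
have ws := step_cover_nbrs ev.
apply: (le_trans (IH (step v e) p _ _ _)); first by case: sp.
- exact: cover_nbrs_is_walk wv ws.
- by rewrite step_endpoint.
by apply: le_nsum_mem => //; exact: iter_nsum_ge0.
Qed.

(** * Sums over balls of the cover and symmetry of its adjacency operator *)

Definition ball_sum N F : R := \sum_(n < N) \sum_(v <- level n) F v.

Lemma ler_ball_sum N F H : (forall v, is_walk v -> F v <= H v) ->
  ball_sum N F <= ball_sum N H.
Proof.
move=> FH; apply: ler_sum => n _; rewrite !big_seq; apply: ler_sum => v vn.
by apply: FH; apply: level_is_walk vn.
Qed.

Lemma eq_ball_sum N F H : (forall v, is_walk v -> F v = H v) ->
  ball_sum N F = ball_sum N H.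
Proof.
by move=> FH; apply/eqP; rewrite eq_le !ler_ball_sum // => v /FH ->.
Qed.

Lemma ball_sumD N F H : ball_sum N (fun v => F v + H v) = ball_sum N F + ball_sum N H.
Proof. by rewrite /ball_sum -big_split; apply: eq_bigr => n _; rewrite big_split. Qed.

Lemma ball_sumZ N a F : ball_sum N (fun v => a * F v) = a * ball_sum N F.
Proof. by rewrite /ball_sum mulr_sumr; apply: eq_bigr => n _; rewrite mulr_sumr. Qed.

(** An edge between two consecutive levels is represented by its end [w] farther from the root,
    whose parent is [behead w]. *)
Let edge_sum F H n := \sum_(w <- level n.+1) F (behead w) * H w.

Let sum_children F H n :
  \sum_(v <- level n) F v * \sum_(w <- children v) H w = edge_sum F H n.
Proof.
rewrite /edge_sum sum_levelS; apply: eq_bigr => v _.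
by rewrite mulr_sumr; apply: eq_big_seq => w /in_children[e [-> _ _]].
Qed.

(** An edge inside the ball is seen from both ends, but an edge leaving the outermost level only
    from its inner end; hence the two ranges of summation. *)
Let ball_sum_covA N F H :
  ball_sum N.+1 (fun v => F v * covA H v)
  = \sum_(n < N.+1) edge_sum F H n + \sum_(n < N) edge_sum H F n.
Proof.
rewrite /ball_sum big_ord_recl big_seq1 covA_nil.
rewrite [in RHS]big_ord_recl -addrA; congr (_ + _).
  by rewrite -sum_children big_seq1.
rewrite -big_split; apply: eq_bigr => n _; rewrite lift0.
rewrite -[edge_sum F H _]sum_children [edge_sum H F n]/edge_sum -big_split.
apply: eq_big_seq => v /size_level; case: v => // f v _.
by rewrite covA_cons mulrDr addrC [X in _ + X]mulrC.
Qed.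

(** The operator is symmetric up to the edges leaving the ball, and these contribute nothing because
    [F] vanishes from the outermost level on. *)
Lemma covA_adjoint N L F H : (forall v, (L <= size v)%N -> F v = 0) ->
  (L < N)%N ->
  ball_sum N (fun v => F v * covA H v) = ball_sum N (fun v => covA F v * H v).
Proof.
case: N => // N F0; rewrite ltnS => LN.
rewrite [RHS](@eq_ball_sum _ _ (fun v => H v * covA F v)); last by move=> *; rewrite mulrC.
rewrite !ball_sum_covA !big_ord_recr /=.
have -> : edge_sum F H N = 0.
  rewrite /edge_sum big_seq big1 // => w /size_level ws.
  by rewrite F0 ?mul0r // size_behead ws.
have -> : edge_sum H F N = 0.
  rewrite /edge_sum big_seq big1 // => w /size_level ws.
  by rewrite F0 ?mulr0 // ws ltnW.
by rewrite !addr0 addrC.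
Qed.

Lemma covA_support L F : (forall v, (L <= size v)%N -> F v = 0) ->
  forall v, (L < size v)%N -> covA F v = 0.
Proof.
move=> F0 [//|f v] /=; rewrite ltnS => Lv; rewrite covA_cons F0 // add0r.
rewrite big_seq big1 // => w /in_children[e [-> _ _]]; apply: F0 => /=.
by lia.
Qed.

Lemma iter_covA_adjoint m N L F H : (forall v, (L <= size v)%N -> F v = 0) ->
  (L + m <= N)%N ->
  ball_sum N (fun v => F v * iter m covA H v)
  = ball_sum N (fun v => iter m covA F v * H v).
Proof.
elim: m L F => [//|m IH] L F F0 LN.
rewrite iterS (@covA_adjoint N L) //; last by lia.
rewrite (IH L.+1) ?iterSr //; first exact: covA_support F0.
by lia.
Qed.

(** * Radial functions and the Green function of the tree *)

Lemma covA_radial_nil (g : nat -> R) :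
  covA (fun v => g (size v)) [::] = d%:R * g 1%N.
Proof.
rewrite covA_nil (eq_big_seq (fun=> g 1%N)).
  by rewrite big_const_seq count_predT size_children_nil iter_addr addr0 mulr_natl.
by move=> w /in_children[e [-> _ _]].
Qed.

Lemma covA_radial_cons (g : nat -> R) f v :
  covA (fun v => g (size v)) (f :: v) = g (size v) + (d.-1)%:R * g (size v).+2.
Proof.
rewrite covA_cons (eq_big_seq (fun=> g (size v).+2)).
  by rewrite big_const_seq count_predT size_children_cons iter_addr addr0 mulr_natl.
by move=> w /in_children[e [-> _ _]].
Qed.

(** With [q = d - 1], the function [2 q^-|v|] is harmonic off the root, and at the root [q >= 2]
    leaves room for the unit source. It therefore remains a bound when the series gets one more
    term. *)
Lemma green_function_le (I : nat) v : (2 < d)%N ->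
  \sum_(i < I) d%:R ^- i * iter i covA (fun v => (v == [::])%:R) v
  <= 2 * (d.-1)%:R ^- size v.
Proof.
move=> d2; set q : R := d.-1%:R; have q2 : 2 <= q by rewrite ler_nat; lia.
have q0 : q != 0 by rewrite gt_eqF // (lt_le_trans _ q2).
have dq : d%:R = q + 1 by rewrite /q natr1 prednK //; lia.
elim: I v => [|I IH] v.
  by rewrite big_ord0 mulr_ge0 // invr_ge0 exprn_ge0 // (le_trans _ q2).
rewrite big_ord_recl /= expr0 invr1 mul1r.
set D := fun v : seq (edge G) => _ in IH *.
have -> : \sum_(i < I) d%:R ^- lift ord0 i * covA (iter i covA D) v
        = d%:R^-1 * covA (fun v => \sum_(i < I) d%:R ^- i * iter i covA D v) v.
  rewrite [in RHS]/nsum exchange_big mulr_sumr; apply: eq_bigr => i _.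
  by rewrite lift0 exprS invfM -mulrA -mulr_sumr.
apply: (@le_trans _ _ (D v + d%:R^-1 * covA (fun v => 2 * q ^- size v) v)).
  by rewrite lerD2l ler_wpM2l ?invr_ge0 //; apply: ler_nsum.
have d0 : d%:R != 0 :> R by rewrite pnatr_eq0; lia.
rewrite -(ler_pM2l (_ : 0 < d%:R)); last by rewrite ltr0n; lia.
rewrite mulrDr mulVKf //; case: v => [|f v].
  rewrite (covA_radial_nil (fun n => 2 * q ^- n)) /D eqxx expr0 expr1 -mulrDr.
  rewrite ler_pM2l ?ltr0n; last by lia.
  rewrite invr1 mulr1 -lerBrDl ler_pdivrMr ?(lt_le_trans _ q2) //.
  by rewrite mulr1n; lra.
rewrite (covA_radial_cons (fun n => 2 * q ^- n)) /D mulr0 add0r -/q dq /=.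
rewrite le_eqVlt; apply/orP; left; apply/eqP.
rewrite !exprS; field.
by rewrite q0 expf_neq0.
Qed.

(** Symmetry moves the iterates from [f] onto the unit mass at the root, and [green_function_le]
    bounds the resulting series. *)
Lemma green_bound (I : nat) (f : vertex G -> R) :
  (2 < d)%N -> (forall x, 0 <= f x) ->
  \sum_(i < I) d%:R ^- i * iter i grA f o
  <= 2 * ball_sum I (fun v => (d.-1)%:R ^- size v * f (endpoint v)).
Proof.
move=> d2 f0; pose D := fun v : seq (edge G) => (v == [::])%:R : R.
have D0 v : (1 <= size v)%N -> D v = 0 by case: v.
have -> : \sum_(i < I) d%:R ^- i * iter i grA f o = ball_sum I (fun v =>
    (\sum_(i < I) d%:R ^- i * iter i covA D v) * f (endpoint v)).
  transitivity (\sum_(i < I) d%:R ^- i *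
      ball_sum I (fun v => iter i covA D v * (f \o endpoint) v)).
    apply: eq_bigr => i _; congr (_ * _).
    rewrite -(@iter_covA_adjoint i I 1) //.
    case: I i => [[]//|I] i; rewrite /ball_sum big_ord_recl big_seq1 /D eqxx mul1r.
    rewrite (iter_covA_endpoint i f (v := [::])) // big1 ?addr0 // => j _.
    rewrite big_seq big1 // => v /size_level; rewrite lift0.
    by case: v => //= e v _; rewrite mul0r.
  under eq_bigr do rewrite -ball_sumZ.
  rewrite /ball_sum exchange_big; apply: eq_bigr => n _.
  rewrite exchange_big; apply: eq_bigr => v _.
  by rewrite mulr_suml; apply: eq_bigr => i _; rewrite mulrA.
rewrite -ball_sumZ; apply: ler_ball_sum => v _.
by rewrite mulrA ler_wpM2r // green_function_le.
Qed.

End Cover.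

(** * Ground-state transform on the cover *)

(** On [[0, 1]] the convex function [(1 + t)^m] lies below its chord between [t = 0] and [t = 1]. *)
Lemma expr1D_le (R : realType) (t : R) m : 0 <= t -> t <= 1 ->
  (1 + t) ^+ m <= 1 + (2 ^+ m - 1) * t.
Proof.
move=> t0 t1; elim: m => [|m IH]; first by rewrite !expr0 subrr mul0r addr0.
rewrite exprS; apply: (@le_trans _ _ ((1 + t) * (1 + (2 ^+ m - 1) * t))).
  by rewrite ler_wpM2l // addr_ge0.
rewrite exprS; have : 1 <= 2 ^+ m :> R by rewrite exprn_ege1 // ler1n.
move: (2 ^+ m) => b b1.
have : 0 <= (b - 1) * (t * (1 - t)) by rewrite !mulr_ge0 // subr_ge0.
by nra.
Qed.

Lemma le_of_perturbation (R : realType) (x c b : R) : 0 <= b ->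
  (forall t, 0 < t -> t <= 1 -> x <= c + t * b) -> x <= c.
Proof.
move=> b0 xt; apply/ler_addgt0Pr => e e0.
pose t := Num.min 1 (e / (b + 1)).
have b1 : 0 < b + 1 by rewrite ltr_wpDl.
have t0 : 0 < t by rewrite lt_min ltr01 divr_gt0.
apply: le_trans (xt t t0 _) _; first by rewrite ge_min lexx.
rewrite lerD2l; apply: (@le_trans _ _ (e / (b + 1) * (b + 1))).
  by apply: ler_pM; rewrite ?ge_min ?lexx ?orbT ?(ltW t0) // lerDl.
by rewrite divfK // gt_eqF.
Qed.

Lemma sum_window (a m M : nat) : (\sum_(n < M) (a <= n < a + m) <= m)%N.
Proof.
(* For the induction on [M] to close, the bound must record how much of the window lies below
   [M]. *)
suff : (\sum_(n < M) (a <= n < a + m) <= minn m (M - a))%N.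
  by move/leq_trans; apply; rewrite geq_minl.
elim: M => [|M IH]; first by rewrite big_ord0.
by rewrite big_ord_recr /=; move: IH; case: (leqP a M); case: (ltnP M (a + m)) => /=; lia.
Qed.

(** The first edges of [p] may cancel against the end of [v]; once an edge has been appended, the
    absence of backtracking in [p] rules out any further cancellation. *)
Lemma steps_cancel (G : multigraph) (v p : seq (edge G)) : nonbacktracking p ->
  exists i s, [/\ (i <= size p)%N, v = map (@flip G) (take i p) ++ s
    & foldl (@step G) v p = rev (drop i p) ++ s].
Proof.
have grow e (w q : seq (edge G)) : path (fun e f => f != flip e) e q ->
    foldl (@step G) (e :: w) q = rev q ++ e :: w.
  elim: q e w => [//|f q IH] e w /= /andP[/negbTE fe nq].
  by rewrite fe IH // rev_cons cat_rcons.
elim: p v => [|e p IH] v nb; first by exists 0%N, v.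
case: v => [|f v].
  by exists 0%N, [::]; rewrite /= grow // rev_cons cats0 -cats1.
have np : nonbacktracking p by exact: path_sorted nb.
have [ef|ef] := eqVneq e (flip f).
  have [i [s [ip vE pE]]] := IH v np.
  by exists i.+1, s; rewrite /= ef eqxx flipK pE -vE; split.
exists 0%N, (f :: v); split=> //.
by rewrite /= (negbTE ef) grow // rev_cons cat_rcons.
Qed.

(** If both lifts kept the distance to the root, each would cancel exactly half of [p]. Comparing
    the two descriptions of the vertex reached after the first lift would make the two central edges
    of [p] reverse to each other. *)
Lemma steps_twice_size (G : multigraph) (v p : seq (edge G)) :
  nonbacktracking p -> (0 < size p)%N ->
  size (foldl (@step G) v p) = size v ->
  size (foldl (@step G) v (p ++ p)) != size v.
Proof.
move=> nb p0; rewrite foldl_cat.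
have [i [s [ip vE pE]]] := steps_cancel v nb.
have [j [t [jp v'E p'E]]] := steps_cancel (foldl (@step G) v p) nb.
move: (foldl (@step G) v p) pE v'E p'E => v' pE v'E p'E sv'; apply/eqP => sv''.
have szv : size v = (i + size s)%N by rewrite vE size_cat size_map size_takel.
have szv' : size v' = (size p - i + size s)%N by rewrite pE size_cat size_rev size_drop.
have szw : size v' = (j + size t)%N by rewrite v'E size_cat size_map size_takel.
have szv'' : size v = (size p - j + size t)%N.
  by rewrite -sv'' p'E size_cat size_rev size_drop.
have ij : j = i by lia.
have ii : size p = i.*2 by lia.
case: i ij ii ip vE pE szv szv' => [|i] ij ii ip vE pE szv szv'; first by lia.
have e0 : edge G by case: (p) p0.
have : nth e0 v' i = nth e0 p i.+1.
  rewrite pE nth_cat size_rev size_drop ii (_ : i < _)%N; last by lia.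
  rewrite nth_rev ?size_drop ii; last by lia.
  by rewrite nth_drop; congr nth; lia.
rewrite {1}v'E nth_cat size_map size_takel ?ij // ltnSn.
rewrite (nth_map e0) ?size_takel // nth_take // => ee.
have ip1 : (i.+1 < size p)%N by lia.
by have /(sortedP e0) /(_ i ip1) := nb; rewrite ee eqxx.
Qed.

Section Energy.
Variables (R : realType) (G : multigraph) (d : nat).
Hypothesis Greg : regular_graph G d.
Variable o : vertex G.
Implicit Types (x y : vertex G) (e : edge G) (p v w : seq (edge G)).
Notation endpt := (endpoint o).
Notation covA := (nsum (R := R) (cover_nbrs o)).
Notation grA := (nsum (R := R) (neighbours (G := G))).

Lemma ler_ball_sum_widen N M (F : seq (edge G) -> R) : (N <= M)%N ->
  (forall v, 0 <= F v) -> ball_sum o N F <= ball_sum o M F.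
Proof.
move=> NM F0; rewrite /ball_sum -!(big_mkord xpredT (fun n => \sum_(v <- level o n) F v)).
rewrite [X in _ <= X](big_cat_nat (n := N)) //= lerDl.
by apply: sumr_ge0 => n _; apply: sumr_ge0.
Qed.

Section Form.
Variables (h : vertex G -> R) (a : R).
Hypotheses (h0 : forall x, 0 < h x) (a0 : 0 <= a).
Hypothesis ha : forall x, grA h x <= a * h x.

(** One term of the Dirichlet form of [phi / h] with conductances [h(v) h(w)], that is, of the Doob
    transform by the positive function [h]. *)
Definition ground_form (phi : seq (edge G) -> R) v w : R :=
  h (endpt v) * h (endpt w) * (phi v / h (endpt v) - phi w / h (endpt w)) ^+ 2.

Lemma ground_form_ge0 phi v w : 0 <= ground_form phi v w.
Proof. by rewrite mulr_ge0 ?sqr_ge0 // mulr_ge0 // ltW. Qed.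

(** Expanding the square gives [F(v) h(w) + h(v) F(w) - 2 phi(v) phi(w)] with [F = phi^2 / h]. The
    first two terms have equal sums by symmetry, and [A^m h <= a^m h] bounds each of them by [a^m]
    times the sum of [phi^2]. *)
Lemma ground_form_energy phi N m M : (forall v, (N <= size v)%N -> phi v = 0) ->
  (N + m <= M)%N ->
  ball_sum o M (fun v => iter m covA (ground_form phi v) v)
  <= 2 * (a ^+ m * ball_sum o M (fun v => phi v ^+ 2)
          - ball_sum o M (fun v => phi v * iter m covA phi v)).
Proof.
move=> phi0 NM; pose H := h \o endpt; pose F v := phi v ^+ 2 / H v.
have H0 v : H v != 0 by apply: lt0r_neq0; apply: h0.
have formE v : ground_form phi v =
    ((fun w => F v * H w) \+ (fun w => H v * F w)) \+ (fun w => - (2 * phi v) * phi w).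
  apply/funext => w; rewrite /ground_form /F /H /=; field.
  by rewrite !lt0r_neq0.
rewrite (@eq_ball_sum _ _ _ Greg _ _ _ (fun v => F v * iter m covA H v + H v * iter m covA F v
    + (- 2) * (phi v * iter m covA phi v))); last first.
  by move=> v _; rewrite formE !iter_nsumD !iter_nsumZ /= mulNr mulNr mulrA.
rewrite !ball_sumD ball_sumZ.
have F0 v : (N <= size v)%N -> F v = 0 by move=> /phi0 p0; rewrite /F p0 expr0n mul0r.
have -> : ball_sum o M (fun v => H v * iter m covA F v)
        = ball_sum o M (fun v => F v * iter m covA H v).
  rewrite (iter_covA_adjoint Greg o H F0 NM).
  by apply: (eq_ball_sum Greg) => v _; rewrite mulrC.
suff : ball_sum o M (fun v => F v * iter m covA H v)
      <= a ^+ m * ball_sum o M (fun v => phi v ^+ 2) by lra.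
rewrite -ball_sumZ; apply: (ler_ball_sum Greg) => v wv.
rewrite (iter_covA_endpoint Greg) //.
apply: (@le_trans _ _ (F v * (a ^+ m * H v))).
  apply: ler_wpM2l; last exact: iter_nsum_super.
  by apply: divr_ge0; [exact: sqr_ge0 | apply: ltW; apply: h0].
by rewrite mulrCA /F divfK.
Qed.

(* [h] takes the same value at both ends of a lifted closed walk. *)
Lemma ground_form_cycle phi k v p : is_walk o v -> walk (endpt v) p (endpt v) ->
  size p = k ->
  (phi v - phi (foldl (@step G) v p)) ^+ 2 <= iter k covA (ground_form phi v) v.
Proof.
move=> wv wp pk.
apply: le_trans (iter_covA_steps Greg (ground_form_ge0 phi v) pk wv wp).
have [_ ep] := steps_walk Greg wv wp.
rewrite /ground_form ep -mulrBl exprMn mulrCA -expr2 exprVn mulfV ?mulr1 //.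
by rewrite expf_neq0 // gt_eqF.
Qed.

End Form.

End Energy.

(** * Cycles seen from the cover *)

Section CycleSum.
Variables (R : realType) (G : multigraph) (d : nat).
Hypothesis Greg : regular_graph G d.
Hypothesis d_gt2 : (2 < d)%N.
Variable o : vertex G.
Implicit Types (x y : vertex G) (e : edge G) (p v w : seq (edge G)).
Notation endpt := (endpoint o).
Notation covA := (nsum (R := R) (cover_nbrs o)).
Notation grA := (nsum (R := R) (neighbours (G := G))).

Let s : R := Num.sqrt d.-1%:R.
Let s2 : s ^+ 2 = d.-1%:R.
Proof. by rewrite sqr_sqrtr // ler0n. Qed.

Let s_gt1 : 1 < s.
Proof.
rewrite -[X in X < _](ger0_norm ler01) -[ltRHS](ger0_norm (sqrtr_ge0 _)).
by rewrite -ltr_sqr ?nnegrE // ?normr_ge0 // !real_normK ?num_real // s2 expr1n ltr1n; lia.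
Qed.

Let s_gt0 : 0 < s. Proof. exact: lt_trans ltr01 s_gt1. Qed.

(* On the tree [q^(-|v|/2)] is an eigenfunction for [2 sqrt q], except at the
   root. *)
Definition critical_fun N v : R := if (size v < N)%N then s ^- size v else 0.

Let critical_ge0 N v : 0 <= critical_fun N v.
Proof. by rewrite /critical_fun; case: ifP => // _; rewrite invr_ge0 exprn_ge0 // ltW. Qed.

(** With [q = d - 1], level [n > 0] has [d q^(n-1)] vertices of mass at most [q^-n] each, and
    [d / q <= 2]. *)
Let sum_critical_sqr N n :
  \sum_(v <- level o n) critical_fun N v ^+ 2 <= 2 * (n < N)%:R.
Proof.
rewrite (eq_big_seq (fun=> (n < N)%:R * (d.-1%:R ^- n))); last first.
  move=> v vn; rewrite /critical_fun (size_level Greg vn).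
  by case: ifP => _; rewrite ?mul1r ?mul0r ?expr0n // exprVn exprAC s2.
have q0 : 0 < d.-1%:R :> R by rewrite ltr0n; lia.
case: n => [|n]; first by rewrite big_seq1 expr0 invr1 mulr1 ler_peMl // ler1n.
rewrite (sum_level_const Greg) mulrCA mulrC; apply: ler_wpM2r => //.
rewrite exprS invfM mulrACA -mulrA divff ?expf_neq0 ?gt_eqF // mulr1.
by rewrite ler_pdivrMr // -natrM ler_nat; lia.
Qed.

Let covA_critical N v : (0 < size v)%N -> (size v + 1 < N)%N ->
  covA (critical_fun N) v = (2 * s) * critical_fun N v.
Proof.
case: v => // f v _; rewrite addn1 => vN.
rewrite (covA_radial_cons Greg o (fun n => if (n < N)%N then s ^- n else 0)) /critical_fun.
rewrite vN !ifT; [|by move: vN => /=; lia..].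
rewrite -s2 /= !exprS; field.
by rewrite expf_neq0 gt_eqF.
Qed.

(** A walk of length [m] from such a level takes no step from the root and stays within the cutoff,
    so the eigenvalue equation applies at each step. *)
Let iter_covA_critical N m v : (m <= size v)%N -> (size v + m < N)%N ->
  (2 * s) ^+ m * critical_fun N v <= iter m covA (critical_fun N) v.
Proof.
elim: m v => [|m IH] v mv vN; first by rewrite mul1r.
rewrite exprSr -mulrA -covA_critical; try lia.
rewrite /= /nsum mulr_sumr !big_seq; apply: ler_sum => w.
rewrite mem_cat => vw; have : (size v <= (size w).+1)%N && (size w <= (size v).+1)%N.
  case/orP: vw => [|/(in_children Greg)[e [-> _ _]] /=]; last by lia.
  by case: v mv vN => // f v _ _; rewrite mem_seq1 => /eqP -> /=; lia.
case/andP => vw1 wv1; apply: IH; first by rewrite -ltnS; exact: leq_trans mv vw1.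
by apply: leq_ltn_trans vN; rewrite addnS -addSn leq_add2r.
Qed.

(** Only the [m] levels next to the root and the [m] levels below the cutoff can contribute. Each
    costs at most [2 (2 s)^m], so that [N] drops out. *)
Let critical_energy N m M : (N + m <= M)%N ->
  (2 * s) ^+ m * ball_sum o M (fun v => critical_fun N v ^+ 2)
  - ball_sum o M (fun v => critical_fun N v * iter m covA (critical_fun N) v)
  <= (2 * s) ^+ m * (4 * m%:R).
Proof.
move=> NM; rewrite -mulN1r -!ball_sumZ -ball_sumD.
pose W n : nat := ((0 <= n < 0 + m) + (N - m <= n < N - m + m))%N.
apply: (@le_trans _ _ (\sum_(n < M) (2 * s) ^+ m * (2 * (W n)%:R))); last first.
  rewrite -mulr_sumr ler_pM2l ?exprn_gt0 ?mulr_gt0 // -mulr_sumr -natr_sum.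
  rewrite big_split /= natrD; have := sum_window 0 m M; have := sum_window (N - m) m M.
  by rewrite -!(ler_nat R); lra.
apply: ler_sum => n _; case: (posnP (W n)) => [W0|Wn]; last first.
  apply: (@le_trans _ _ (\sum_(v <- level o n) (2 * s) ^+ m * critical_fun N v ^+ 2)).
    apply: ler_sum => v _; rewrite mulN1r gerDl oppr_le0 mulr_ge0 //.
    exact: iter_nsum_ge0.
  rewrite -mulr_sumr ler_pM2l ?exprn_gt0 ?mulr_gt0 //.
  apply: le_trans (sum_critical_sqr _ _) _; rewrite ler_pM2l // ler_nat.
  by case: (_ < _)%N.
have /andP[W1 W2] : ~~ (n < m)%N && ~~ (N - m <= n < N - m + m)%N.
  by move/eqP: W0; rewrite /W addn_eq0 !eqb0.
rewrite W0 !mulr0 big_seq; apply: sumr_le0 => v /(size_level Greg) vn.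
have [Nv|vN] := leqP N (size v).
  by rewrite /critical_fun ltnNge Nv /= expr0n mul0r !mulr0 addr0.
rewrite mulN1r subr_le0 expr2 mulrCA ler_wpM2l //; apply: iter_covA_critical.
  by rewrite vn; lia.
by rewrite vn; move: vN; rewrite vn; lia.
Qed.

(** Moving away from the root multiplies the value by at most [1/s], the cutoff only lowering it
    further; moving towards the root multiplies it by at least [s], and [s - 1 >= 1 - 1/s]. *)
Let critical_jump N v w : (size v < N)%N -> size w != size v ->
  (1 - s^-1) ^+ 2 * critical_fun N v ^+ 2
  <= (critical_fun N v - critical_fun N w) ^+ 2.
Proof.
move=> vN wv; set b := critical_fun N v.
have b0 : 0 <= b by exact: critical_ge0.
have s1 : s^-1 < 1 by rewrite invf_lt1.
have s10 : 0 < s^-1 by rewrite invr_gt0.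
rewrite -exprMn -[leRHS]real_normK ?num_real // ler_sqr ?nnegrE ?normr_ge0 //; last first.
  by rewrite mulr_ge0 // subr_ge0 ltW.
have [lt_vw|lt_wv|/eqP] := ltngtP (size v) (size w); last by rewrite eq_sym (negbTE wv).
  have : critical_fun N w <= s^-1 * b.
    rewrite /critical_fun; case: ifP => _; last by rewrite mulr_ge0 // ltW.
    rewrite /b /critical_fun vN -invfM -exprS lef_pV2 ?posrE ?exprn_gt0 //.
    by rewrite ler_weXn2l // ltW.
  move=> wb; apply: le_trans (ler_norm _).
  by rewrite mulrBl mul1r lerB.
have : s * b <= critical_fun N w.
  rewrite /critical_fun (ltn_trans lt_wv vN) /b /critical_fun vN.
  rewrite -(subnKC lt_wv) exprD exprS !invfM -mulrA mulVKf ?gt_eqF //.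
  rewrite ler_piMr ?invr_ge0 ?exprn_ge0 ?(ltW s_gt0) //.
  by rewrite invf_le1 ?exprn_gt0 // exprn_ege1 // ltW.
move=> sb; rewrite distrC; apply: le_trans (ler_norm _).
have : (1 - s^-1) * b <= (s - 1) * b; last by lra.
apply: ler_wpM2r => //; rewrite -(ler_pM2l s_gt0) mulrBr mulfV ?gt_eqF // mulr1.
by move: s_gt1; nra.
Qed.

Lemma walk_cat x p y q z : walk x p y -> walk y q z -> walk x (p ++ q) z.
Proof. by elim: p x => [|e p IH] x /= => [->//|[ex /IH py /py]]. Qed.

(** By [steps_twice_size] the lift of the cycle or that of its double changes level, and
    [critical_jump] bounds the matching term. The double may backtrack where its two copies meet;
    that lemma only asks [p] itself to be non-backtracking. *)
Lemma cycle_form_ge (h : vertex G -> R) N k v :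
  (forall x, 0 < h x) -> (0 < k)%N -> is_walk o v -> (size v < N)%N ->
  cycle_at (endpt v) k ->
  (1 - s^-1) ^+ 2 * critical_fun N v ^+ 2
  <= iter k covA (ground_form o h (critical_fun N) v) v
     + iter k.*2 covA (ground_form o h (critical_fun N) v) v.
Proof.
move=> h0 k0 wv vN [p [pk wp nb]].
have it0 m : 0 <= iter m covA (ground_form o h (critical_fun N) v) v.
  by apply: iter_nsum_ge0 => w; exact: ground_form_ge0.
have szpp : size (p ++ p) = k.*2 by rewrite size_cat pk addnn.
have [sp|sp] := eqVneq (size (foldl (@step G) v p)) (size v).
  have /(critical_jump vN)/le_trans := steps_twice_size nb (etrans (congr1 _ pk) k0) sp.
  move=> /(_ _ (ground_form_cycle Greg h0 _ wv (walk_cat wp wp) szpp))/le_trans; apply.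
  by rewrite lerDr.
have /le_trans := critical_jump vN sp.
move=> /(_ _ (ground_form_cycle Greg h0 _ wv wp pk))/le_trans; apply.
by rewrite lerDl.
Qed.

(* The truncation costs an amount independent of the radius [N], while each
   cycle met at distance [n] contributes at least a constant times [q^-n]. *)
Lemma cycle_sum_bounded k : (0 < k)%N ->
  (forall a, 2 * s < a ->
     exists h : vertex G -> R, (forall x, 0 < h x) /\ forall x, grA h x <= a * h x) ->
  exists C, forall N, ball_sum o N (fun v =>
    (d.-1)%:R ^- size v * cycle_indicator R k (endpt v)) <= C.
Proof.
move=> k0 super; pose kappa := (1 - s^-1) ^+ 2.
have kappa0 : 0 < kappa by rewrite exprn_gt0 // subr_gt0 invf_lt1.
(* Twice the bound of [critical_energy]; the factor two comes from [ground_form_energy]. *)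
pose C m := 2 * ((2 * s) ^+ m * (4 * m%:R)).
exists ((C k + C k.*2) / kappa) => N; rewrite ler_pdivlMr // mulrC.
pose M := (N + k.*2)%N; pose T := ball_sum o M (fun v => critical_fun N v ^+ 2).
have T0 : 0 <= T by rewrite sumr_ge0 // => n _; rewrite sumr_ge0 // => v _; exact: sqr_ge0.
(* The price of working at [2 s (1 + t)] instead of [2 s], linear in [t] by [expr1D_le]. It depends
   on [N] through [T], so [t] tends to zero while [N] is fixed. *)
pose D m := 2 * ((2 * s) ^+ m * (2 ^+ m - 1) * T).
have s20 m : 0 <= (2 * s) ^+ m by rewrite exprn_ge0 // mulr_ge0 // ltW.
have D0 m : 0 <= D m.
  by rewrite !mulr_ge0 // subr_ge0 exprn_ege1 // ler1n.
apply: (@le_of_perturbation _ _ _ (D k + D k.*2)); first exact: addr_ge0.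
move=> t t0 t1; have [|h [h0 ha]] := super (2 * s * (1 + t)).
  by rewrite ltr_pMr ?mulr_gt0 // ltrDl.
pose K m v := iter m covA (ground_form o h (critical_fun N) v) v.
have K0 m v : 0 <= K m v by apply: iter_nsum_ge0 => w; exact: ground_form_ge0.
have Kle m : (N + m <= M)%N -> ball_sum o M (K m) <= C m + t * D m.
  move=> NM; have a0 : 0 <= 2 * s * (1 + t) by rewrite !mulr_ge0 ?ltW // addr_gt0.
  have crit0 v : (N <= size v)%N -> critical_fun N v = 0.
    by rewrite /critical_fun ltnNge => ->.
  apply: le_trans (ground_form_energy Greg o h0 a0 ha crit0 NM) _.
  rewrite /C /D [t * _]mulrCA -mulrDr ler_pM2l //.
  have := critical_energy NM; rewrite -/T => ce.
  have : (2 * s * (1 + t)) ^+ m * T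
      <= (2 * s) ^+ m * T + t * ((2 * s) ^+ m * (2 ^+ m - 1) * T).
    have -> : (2 * s) ^+ m * T + t * ((2 * s) ^+ m * (2 ^+ m - 1) * T)
       = (2 * s) ^+ m * (1 + (2 ^+ m - 1) * t) * T by ring.
    by rewrite exprMn ler_wpM2r // ler_wpM2l // expr1D_le // ltW.
  by lra.
apply: (@le_trans _ _ (ball_sum o M (fun v => K k v + K k.*2 v))); last first.
  rewrite ball_sumD; have := Kle k; have := Kle k.*2 (leqnn _).
  have -> : (N + k <= M)%N by rewrite leq_add2l -addnn leq_addr.
  by move=> + /(_ isT); lra.
rewrite -ball_sumZ; apply: (@le_trans _ _ (ball_sum o N (fun v => K k v + K k.*2 v))); last first.
  by apply: ler_ball_sum_widen; [exact: leq_addr | move=> v; exact: addr_ge0].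
apply: ler_sum => n _; rewrite !big_seq; apply: ler_sum => v vn.
have wv := level_is_walk Greg vn; have sv := size_level Greg vn.
have vN : (size v < N)%N by rewrite sv.
rewrite /cycle_indicator indicE; case: (boolP (_ \in _)) => [/set_mem /= ck|_]; last first.
  by rewrite !mulr0 addr_ge0.
rewrite mulr1; apply: le_trans (cycle_form_ge h0 k0 wv vN ck).
by rewrite /critical_fun vN exprVn exprAC s2.
Qed.

End CycleSum.

(** * The spectral radius of the tree *)

Lemma l2norm_leP (R : realType) (G : multigraph) (f : vertex G -> R) (b : R) :
  0 <= b -> (l2norm f <= b%:E)%E
            = (\esum_(x in [set: vertex G]) ((f x) ^+ 2)%:E <= (b ^+ 2)%:E)%E.
Proof.
move=> b0; rewrite -[in RHS]lee_sqrt ?lee_fin ?sqr_ge0 //.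
by rewrite /l2norm /= sqrtr_sqr ger0_norm.
Qed.

Lemma esumZ_le (R : realType) (T : choiceType) (c : R) (a : T -> R) :
  0 <= c -> (forall x, 0 <= a x) ->
  (\esum_(x in [set: T]) (c * a x)%:E <= c%:E * \esum_(x in [set: T]) (a x)%:E)%E.
Proof.
move=> c0 a0; apply: ub_ereal_sup => _ [X [finX _] <-].
rewrite (fsbig_finite _ _ finX) /=; under eq_bigr do rewrite EFinM.
rewrite -ge0_sume_distrr; last by move=> i _; rewrite lee_fin.
apply: lee_wpmul2l; first by rewrite lee_fin.
by rewrite -(fsbig_finite _ _ finX); apply: ereal_sup_ubound; exists X.
Qed.

(** Weighted Cauchy-Schwarz inequality, from expanding the nonnegative sum of
    [a_i (b_i / a_i - B / L)^2], where [B] is the sum of the [b_i]. *)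
Lemma sqr_sum_weighted (R : realFieldType) (I : finType) (a b : I -> R) (L : R) :
  (forall i, 0 < a i) -> 0 < L -> \sum_i a i <= L ->
  (\sum_i b i) ^+ 2 <= L * \sum_i (b i ^+ 2 / a i).
Proof.
move=> a0 L0 aL; set Q := \sum_i (_ / _).
have [B BE] : exists B, B = \sum_i b i by eexists.
rewrite -BE.
have : 0 <= \sum_i a i * (b i / a i - B / L) ^+ 2.
  by apply: sumr_ge0 => i _; rewrite mulr_ge0 ?sqr_ge0 ?ltW.
have -> : \sum_i a i * (b i / a i - B / L) ^+ 2
        = Q - (2 * B / L) * B + (B / L) ^+ 2 * \sum_i a i.
  rewrite /Q [X in _ - _ * X + _]BE !mulr_sumr -sumrB -big_split; apply: eq_bigr => i _ /=.
  by field; rewrite !gt_eqF.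
have le1 : (B / L) ^+ 2 * \sum_i a i <= (B / L) ^+ 2 * L by rewrite ler_wpM2l ?sqr_ge0.
have e1 : (B / L) ^+ 2 * L = B ^+ 2 / L by field; rewrite gt_eqF.
have e2 : 2 * B / L * B = 2 * (B ^+ 2 / L) by field; rewrite gt_eqF.
rewrite e1 in le1; rewrite e2 => H.
have : B ^+ 2 / L <= Q by lra.
by rewrite ler_pdivrMr // mulrC.
Qed.

Section TreeNorm.
Variables (R : realType) (d : nat).
Hypothesis d_gt2 : (2 < d)%N.
Let T := regular_tree d.
Let s : R := Num.sqrt d.-1%:R.
Let s_gt0 : 0 < s. Proof. by rewrite sqrtr_gt0 ltr0n; lia. Qed.
Let s2 : s ^+ 2 = d.-1%:R. Proof. by rewrite sqr_sqrtr // ler0n. Qed.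

Lemma averaging_tree (f : vertex T -> R) (w : tree_vertex d) :
  averaging (G := T) d f w = d%:R^-1 * \sum_(i < d) f (tree_step w i).
Proof.
rewrite /averaging; congr (_ * _).
rewrite (_ : star (G := T) w = range (fun i : 'I_d => (w, i) : edge T)).
  rewrite fsbig_image; last by move=> i j _ _ [].
  rewrite fsbig_finite; last exact: finite_finset.
  transitivity (\sum_(i <- fset_set [set: 'I_d]) f (tree_step w i)) => //.
  apply: perm_big; apply: uniq_perm; rewrite ?fset_uniq ?index_enum_uniq // => i.
  by rewrite mem_index_enum in_fset_set; [exact: mem_set | exact: finite_finset].
apply/seteqP; split=> [[v i] /= <-|_ [i _ <-]] //; by exists i.
Qed.

Definition tree_weight (w : tree_vertex d) : R := s ^- size (val w).

Let tree_weight_gt0 w : 0 < tree_weight w.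
Proof. by rewrite invr_gt0 exprn_gt0. Qed.

(** Off the root the parent contributes [s] and the [d - 1] children [1/s] each, in total [2 s]; at
    the root [d / s <= 2 s] because [d <= 2 (d - 1)]. *)
Lemma sum_tree_weight w :
  \sum_(i < d) tree_weight (tree_step w i) / tree_weight w <= 2 * s.
Proof.
rewrite -mulr_suml ler_pdivrMr //.
case: w => -[|j w] rw; rewrite /tree_weight /=.
  rewrite (eq_bigr (fun=> s^-1)) => [|i _]; last by rewrite expr1.
  rewrite sumr_const card_ord expr0 invr1 mulr1 -[X in X <= _]mulr_natl ler_pdivrMr // -mulrA -expr2 s2.
  by rewrite -natrM ler_nat; lia.
rewrite (bigD1 j) //= eqxx (eq_bigr (fun=> s ^- (size w).+2)) => [|i /negbTE -> //].
rewrite sumr_const (_ : #|_| = d.-1)%N; last by rewrite cardC1 card_ord.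
rewrite -[X in _ + X]mulr_natl -s2 !exprS le_eqVlt; apply/orP; left; apply/eqP; field.
by rewrite expf_neq0 gt_eqF.
Qed.

Lemma tree_stepK (i : 'I_d) : involutive (fun w : tree_vertex d => tree_step w i).
Proof. by move=> w; have := tree_flipK (w, i) => -[]. Qed.

(* Schur's test with the weight [(d-1)^(-|w|/2)] *)
Lemma spectral_radius_tree :
  (spectral_radius (regular_tree d) R d <= (2 * s / d%:R)%:E)%E.
Proof.
apply: ub_ereal_sup => _ [f f1 <-]; rewrite /= in f1.
have f1' : (\esum_(x in [set: vertex T]) ((f x) ^+ 2)%:E <= 1%:E)%E.
  by rewrite -[X in (_ <= X%:E)%E](expr1n R 2) -l2norm_leP.
have c0 : 0 <= 2 * s / d%:R by rewrite divr_ge0 // mulr_ge0 // ltW.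
rewrite l2norm_leP //.
pose b w i := tree_weight w / tree_weight (tree_step w i) * f (tree_step w i) ^+ 2.
have b0 w i : 0 <= b w i by rewrite mulr_ge0 ?sqr_ge0 // divr_ge0 // ltW.
have avg_le (w : vertex T) : averaging d f w ^+ 2 <= (2 * s / d%:R ^+ 2) * \sum_(i < d) b w i.
  rewrite averaging_tree exprMn.
  have := sqr_sum_weighted (fun i => f (tree_step w i))
    (fun i => divr_gt0 (tree_weight_gt0 (tree_step w i)) (tree_weight_gt0 w))
    (mulr_gt0 (ltr0Sn R 1) s_gt0) (sum_tree_weight w).
  rewrite [X in _ <= _ * X -> _](eq_bigr (b w)) => [le1|i _]; last by rewrite /b invf_div mulrC.
  rewrite [leRHS](_ : _ = d%:R^-1 ^+ 2 * (2 * s * \sum_(i < d) b w i)); last by rewrite exprVn; ring.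
  by rewrite ler_wpM2l // sqr_ge0.
apply: (@le_trans _ _ (\esum_(w in [set: vertex T]) (2 * s / d%:R ^+ 2 * \sum_(i < d) b w i)%:E)).
  by apply: le_esum => w _; rewrite lee_fin.
have k0 : 0 <= 2 * s / d%:R ^+ 2 by rewrite divr_ge0 ?exprn_ge0 // mulr_ge0 // ltW.
apply: le_trans (esumZ_le k0 _) _; first by move=> w; apply: sumr_ge0.
rewrite (_ : (2 * s / d%:R) ^+ 2 = 2 * s / d%:R ^+ 2 * (2 * s)); last first.
  by rewrite exprMn exprVn; ring.
rewrite [X in (_ <= X)%E]EFinM; apply: lee_wpmul2l; first by rewrite lee_fin.
under eq_esum do rewrite -sumEFin.
rewrite esum_sum; last by move=> w i _ _; rewrite lee_fin.
(* Following the letter [i] is an involution of the tree. Reindexing by it inverts the ratio of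
   weights, so that [sum_tree_weight] can be used a second time. *)
rewrite (eq_bigr (fun i => \esum_(w in [set: vertex T])
    (tree_weight (tree_step w i) / tree_weight w * f w ^+ 2)%:E)%E) => [|i _]; last first.
  rewrite (@reindex_esum _ _ _ setT setT (fun w => tree_step w i)).
    by apply: eq_esum => w _; rewrite /b tree_stepK.
  have sK := tree_stepK i; rewrite setTT_bijective.
  exact: inv_bij.
rewrite -esum_sum; last first.
  by move=> w i _ _; rewrite lee_fin mulr_ge0 ?sqr_ge0 // divr_ge0 // ltW.
apply: (@le_trans _ _ (\esum_(w in [set: vertex T]) (2 * s * f w ^+ 2)%:E)%E).
  apply: le_esum => w _; rewrite sumEFin lee_fin -mulr_suml ler_wpM2r ?sqr_ge0 //.
  exact: sum_tree_weight.
have s20 : 0 <= 2 * s by rewrite mulr_ge0 // ltW.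
apply: le_trans (esumZ_le s20 _) _; first by move=> w; exact: sqr_ge0.
by rewrite -[X in (_ <= X)%E]mule1; apply: lee_wpmul2l; rewrite ?lee_fin.
Qed.

End TreeNorm.

(** * Positive supersolutions *)

Lemma cvg_sum_seq (R : realType) (I : Type) (l : seq I) (u : I -> nat -> R)
    (h : I -> R) : (forall i, u i n @[n --> \oo] --> h i) ->
  \sum_(i <- l) u i n @[n --> \oo] --> \sum_(i <- l) h i.
Proof.
move=> uh; elim: l => [|i l IH].
  by rewrite big_nil; under eq_fun do rewrite big_nil; exact: cvg_cst.
by rewrite big_cons; under eq_fun do rewrite big_cons; exact: cvgD.
Qed.

Section Supersolution.
Variables (R : realType) (G : multigraph) (d : nat).
Hypothesis Greg : regular_graph G d.
Hypothesis Gcon : connected_graph G.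
Hypothesis d_gt0 : (0 < d)%N.
Variables (o : vertex G) (r : R).
Hypothesis r_gt0 : 0 < r.
Hypothesis radius_le : (spectral_radius G R d <= r%:E)%E.
Notation grA := (nsum (R := R) (neighbours (G := G))).

Let delta (x : vertex G) : R := (x == o)%:R.
Let delta_ge0 x : 0 <= delta x. Proof. exact: ler0n. Qed.

(** The neighbour sum is [d] times averaging. Dividing the iterate by [(d r)^m] puts it in the unit
    ball over which [spectral_radius] takes its supremum. *)
Lemma iter_nsum_l2 m :
  (\esum_(x in [set: vertex G]) (iter m grA delta x ^+ 2)%:E
   <= (((d%:R * r) ^+ m) ^+ 2)%:E)%E.
Proof.
elim: m => [|m IH].
  rewrite expr0 expr1n (eq_esum (b := fun x => if x \in [set o] then 1%:E else 0%E)).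
    by rewrite -esum_mkcond esum_set1.
  move=> x _; rewrite /= /delta; case: (eqVneq x o) => [->|xo].
    by rewrite mem_set // expr1n.
  by rewrite memNset ?expr0n // => /eqP; rewrite (negbTE xo).
have dr0 : 0 < d%:R * r by rewrite mulr_gt0 // ltr0n.
set b := (d%:R * r) ^+ m in IH *; have b0 : 0 < b by exact: exprn_gt0.
pose g x := b^-1 * iter m grA delta x.
have g1 : (l2norm g <= 1)%E.
  rewrite (l2norm_leP g ler01) expr1n /g; under eq_esum do rewrite exprMn.
  apply: le_trans (esumZ_le (sqr_ge0 _) _) _; first by move=> x; exact: sqr_ge0.
  have -> : 1%:E = ((b^-1 ^+ 2)%:E * (b ^+ 2)%:E)%E :> \bar R.
    by rewrite -EFinM -exprMn mulVf ?expr1n // gt_eqF.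
  by apply: lee_wpmul2l => //; rewrite lee_fin sqr_ge0.
have : (l2norm (averaging d g) <= r%:E)%E.
  by apply: le_trans radius_le; apply: ereal_sup_ubound; exists g.
rewrite (l2norm_leP _ (ltW r_gt0)) => avg_le.
have avgE x : iter m.+1 grA delta x ^+ 2 = (d%:R * b) ^+ 2 * averaging d g x ^+ 2.
  rewrite (averagingE Greg) /g nsumZ iterS -exprMn; congr (_ ^+ 2).
  by field; rewrite pnatr_eq0 -lt0n d_gt0 gt_eqF.
under eq_esum do rewrite avgE.
apply: le_trans (esumZ_le (sqr_ge0 _) _) _; first by move=> x; exact: sqr_ge0.
have -> : ((d%:R * r) ^+ m.+1) ^+ 2 = (d%:R * b) ^+ 2 * r ^+ 2.
  by rewrite [(_ * r) ^+ m.+1]exprSr -/b -exprMn mulrCA mulrA.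
by rewrite [X in (_ <= X)%E]EFinM; apply: lee_wpmul2l => //; rewrite lee_fin sqr_ge0.
Qed.

Lemma iter_nsum_le m x : iter m grA delta x <= (d%:R * r) ^+ m.
Proof.
have it0 := iter_nsum_ge0 (neighbours (G := G)) m delta_ge0 x.
have b0 : 0 <= (d%:R * r) ^+ m by rewrite exprn_ge0 // mulr_ge0 // ltW.
rewrite -ler_sqr ?nnegrE // -lee_fin; apply: le_trans (iter_nsum_l2 m).
by apply: esum_ge; exists [set x]; rewrite ?fsbig_set1.
Qed.

(** The series of [a^-m A^m delta] converges by comparison with a geometric series of ratio
    [d r / a], and is positive at [x] because some walk joins [x] to [o]. Applying [A] shifts it by
    one term and multiplies it by [a]. *)
Lemma supersolution a : d%:R * r < a ->
  exists h : vertex G -> R, (forall x, 0 < h x) /\ forall x, grA h x <= a * h x.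
Proof.
move=> ra; have dr0 : 0 < d%:R * r by rewrite mulr_gt0 // ltr0n.
have a0 : 0 < a by exact: lt_trans ra.
pose t m x : R := a ^- m * iter m grA delta x.
have t0 m x : 0 <= t m x.
  by rewrite mulr_ge0 ?iter_nsum_ge0 // invr_ge0 exprn_ge0 // ltW.
pose u x n := \sum_(m < n) t m x.
have u_nd x : {homo u x : n m / (n <= m)%N >-> n <= m}.
  apply/nondecreasing_seqP => n; rewrite /u big_ord_recr lerDl; exact: t0.
have u_ub x : has_ubound (range (u x)).
  pose z := d%:R * r / a.
  have z0 : 0 <= z by rewrite divr_ge0 // ltW.
  have z1 : z < 1 by rewrite ltr_pdivrMr // mul1r.
  exists (1 - z)^-1 => _ [n _ <-].
  rewrite -[leRHS]mul1r ler_pdivlMr ?subr_gt0 //.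
  apply: (@le_trans _ _ ((\sum_(m < n) z ^+ m) * (1 - z))).
    apply: ler_wpM2r; first by rewrite subr_ge0 ltW.
    apply: ler_sum => m _; rewrite /t /z exprMn mulrC exprVn.
    by rewrite ler_wpM2r ?iter_nsum_le // invr_ge0 exprn_ge0 // ltW.
  by have := subrX1 z n; have := exprn_ge0 n z0; lra.
pose h x : R := limn (u x).
have u_cvg x : u x n @[n --> \oo] --> h x by exact: nondecreasing_is_cvgn.
have u_le x n : u x n <= h x by apply: nondecreasing_cvgn_le => //; apply: u_cvg.
exists h; split=> x.
  have [p wp] := Gcon x o.
  apply: lt_le_trans (u_le x (size p).+1); rewrite /u big_ord_recr /=.
  rewrite ltr_wpDl ?sumr_ge0 // mulr_gt0 ?invr_gt0 ?exprn_gt0 //.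
  apply: lt_le_trans (iter_nsum_walk Greg delta_ge0 (erefl _) wp).
  by rewrite /delta eqxx.
have cvA := cvg_sum_seq (l := neighbours x) u_cvg.
apply: (cvgr_to_le cvA); apply: nearW => n.
have -> : \sum_(y <- neighbours x) u y n = a * \sum_(m < n) t m.+1 x.
  rewrite /u exchange_big mulr_sumr; apply: eq_bigr => m _.
  by rewrite /t -mulr_sumr exprS invfM !mulrA mulfV ?mul1r // gt_eqF.
rewrite ler_pM2l //; apply: le_trans (u_le x n.+1).
by rewrite /u big_ord_recl /= lerDr.
Qed.

End Supersolution.

(** * Infinite regular graphs *)

Lemma walk_cat_inv (G : multigraph) (x z : vertex G) p q :
  walk x (p ++ q) z -> exists y, walk x p y /\ walk y q z.
Proof.
elim: p x => [|e p IH] x /=; first by exists x.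
by case=> ex /IH[y [py qz]]; exists y.
Qed.

Lemma backtrackP (G : multigraph) (p : seq (edge G)) : ~~ nonbacktracking p ->
  exists u f w, p = u ++ f :: flip f :: w.
Proof.
elim: p => [//|e [//|f p] IH]; rewrite /nonbacktracking /= negb_and negbK.
case/orP => [/eqP ->|/IH[u [g [w ->]]]]; first by exists [::], e, p.
by exists (e :: u), g, w.
Qed.

Fixpoint reach (G : multigraph) n (x : vertex G) : seq (vertex G) :=
  x :: (if n is n'.+1 then flatten [seq reach n' y | y <- neighbours x] else [::]).

Section Infinite.
Variables (G : multigraph) (d : nat).
Hypothesis Ginf : infinite_set [set: vertex G].
Hypothesis Gcon : connected_graph G.
Hypothesis Greg : regular_graph G d.
Implicit Types (x y z : vertex G) (e f : edge G) (p q : seq (edge G)) (l : seq (vertex G)).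

Lemma mem_reach n x p y : (size p <= n)%N -> walk x p y -> y \in reach n x.
Proof.
elim: n x p => [|n IH] x [|e p] //=; try by move=> _ ->; rewrite mem_head.
rewrite ltnS => pn [ex wp]; rewrite in_cons; apply/orP; right.
apply/flattenP; exists (reach n (tgt e)); last exact: IH wp.
by apply: map_f; rewrite -ex (mem_neighbours Greg).
Qed.

(** Some vertex lies outside the finite list, and a walk from [x] to it must leave the list along
    some edge. *)
Lemma exit_edge l x : x \in l -> exists e, src e \in l /\ tgt e \notin l.
Proof.
move=> xl; have [z zl] : exists z, z \notin l.
  apply: contrapT => nz; apply: Ginf; apply: (sub_finite_set (B := [set` l])).
    by move=> z _ /=; apply: contrapT => zl; apply: nz; exists z; apply/negP.
  exact: finite_seq.
have [p] := Gcon x z; elim: p x xl => [|e p IH] x xl /=.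
  by move=> xz; rewrite xz (negbTE zl) in xl.
case=> ex wp; have [el|el] := boolP (tgt e \in l); first exact: IH wp.
by exists e; rewrite ex.
Qed.

Lemma large_ball n y : exists l, [/\ uniq l, size l = n.+1
  & forall z, z \in l -> exists2 p, (size p <= n)%N & walk y p z].
Proof.
elim: n => [|n [l [ul sl lw]]].
  exists [:: y]; split=> // z; rewrite mem_seq1 => /eqP ->.
  by exists [::].
have [x xl] : exists x, x \in l by case: (l) sl => // x l' _; exists x; exact: mem_head.
have [e [el nel]] := exit_edge xl.
exists (tgt e :: l); split; rewrite /= ?nel ?sl // => z.
rewrite in_cons => /orP[/eqP ->|/lw[p pn wp]]; last by exists p => //; exact: leqW.
have [p pn wp] := lw _ el.
exists (rcons p e); first by rewrite size_rcons.
by rewrite -cats1; apply: walk_cat wp _.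
Qed.

Lemma regular_degree_gt0 : (0 < d)%N.
Proof.
have [x _] : exists x : vertex G, True.
  by apply: contrapT => nx; apply: Ginf; rewrite (_ : setT = set0) //; apply/seteqP;
    split=> // x _; apply: nx; exists x.
have [e [ex _]] := exit_edge (mem_head x [::]).
by rewrite -(size_out_edges Greg (src e)) -has_predT; apply/hasP; exists e;
  rewrite ?(mem_out_edges Greg).
Qed.

Section MaximumPrinciple.
Variables (R : realType).
Notation grA := (nsum (R := R) (neighbours (G := G))).

Let d_gt0 := regular_degree_gt0.

(* Where a nearly harmonic function is close to its supremum, so are its
   values at the neighbours; an infinite graph has too many of them. *)
Lemma nearly_harmonic_small (g : vertex G -> R) (eta : R) n :
  0 < eta -> (forall l, uniq l -> \sum_(z <- l) g z <= 1) ->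
  (forall y, d%:R * (g y - eta) <= grA g y) ->
  forall z, g z <= n.+1%:R^-1 + (2 * d%:R) ^+ n * eta.
Proof.
move=> eta0 mass harm z.
have g1 x : g x <= 1 by have := mass [:: x] isT; rewrite big_seq1.
have hs : has_sup (range g).
  by split; [exists (g z), z | exists 1 => _ [x _ <-]].
pose M := sup (range g).
have gM x : g x <= M by apply: sup_upper_bound => //; exists x.
have [_ [y _ <-] yM] := sup_adherent eta0 hs; rewrite -/M in yM.
have d0 : 0 < d%:R :> R by rewrite ltr0n.
have d2 : 1 <= 2 * d%:R :> R by rewrite -natrM ler1n; lia.
(* A gap [c eta] below the supremum at [x] becomes at most [d (c + 1) eta <= 2 d c eta] at a
   neighbour, since no other neighbour exceeds [M]. *)
have near x p w c : 1 <= c -> M - c * eta <= g x -> walk x p w ->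
    M - (2 * d%:R) ^+ size p * c * eta <= g w.
  elim: p x c => [|e p IH] x c c1 cx /=; first by move=> <-; rewrite mul1r.
  case=> ex wp; rewrite exprSr -(mulrA _ (2 * d%:R)); apply: IH wp.
    by apply: le_trans d2 _; rewrite ler_peMr // (le_trans ler01).
  have ei : e \in out_edges x by rewrite (mem_out_edges Greg) ex.
  have := harm x; rewrite nsum_neighbours (perm_big _ (perm_to_rem ei)) big_cons.
  have : \sum_(f <- rem e (out_edges x)) g (tgt f) <= (d.-1)%:R * M.
    rewrite (le_trans (ler_sum _ (fun f _ => gM (tgt f)))) //.
    by rewrite big_const_seq count_predT iter_addr addr0 size_rem // (size_out_edges Greg) mulr_natl.
  have dE : d%:R = (d.-1)%:R + 1 :> R by rewrite natr1 prednK.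
  have q0 : 0 <= (d.-1)%:R :> R by rewrite ler0n.
  move=> le1 /= le2.
  have : d%:R * (M - c * eta - eta) <= d%:R * (g x - eta) by rewrite ler_pM2l // lerD2r.
  have : d%:R * eta <= d%:R * (c * eta) by rewrite ler_pM2l // ler_peMl // ltW.
  move: le1 le2; rewrite -mulrA.
  have -> : d%:R * (M - c * eta - eta) = (d.-1)%:R * M + M - d%:R * (c * eta) - d%:R * eta.
    by rewrite !mulrBr {1}dE mulrDl mul1r.
  by lra.
have [l [ul sl lw]] := large_ball n y.
apply: le_trans (gM z) _.
have : n.+1%:R * (M - (2 * d%:R) ^+ n * eta) <= 1.
  apply: le_trans (mass l ul); rewrite -sl mulr_natl -iter_addr_0 -(count_predT l).
  rewrite -big_const_seq !big_seq; apply: ler_sum => w /lw[p pn wp].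
  apply: le_trans (near y p w 1 (lexx _) _ wp); last by rewrite mul1r ltW.
  by rewrite lerD2l lerN2 mulr1 ler_pM2r // ler_weXn2l.
by rewrite -ler_pdivlMl ?ltr0n // mulr1 lerBlDr.
Qed.

(** The neighbour sum sends the unit mass at [x] to the sum of the unit masses at the ends of the
    [d] edges from [x]; the induction runs over all starting points. *)
Lemma iter_delta_mass i x l : uniq l ->
  \sum_(z <- l) iter i grA (fun y => (y == x)%:R) z <= d%:R ^+ i.
Proof.
elim: i x => [|i IH] x ul.
  rewrite expr0 /=; have [xl|xl] := boolP (x \in l).
    rewrite (perm_big _ (perm_to_rem xl)) big_cons eqxx /= big_seq big1 ?addr0 // => z.
    by rewrite mem_rem_uniq // ssrbool.inE => /andP[/negbTE ->].
  by rewrite big_seq big1 // => z zl; case: eqP => // zx; rewrite -zx zl in xl.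
have -> : iter i.+1 grA (fun y => (y == x)%:R)
        = fun z => \sum_(e <- out_edges x) iter i grA (fun y => (y == tgt e)%:R) z.
  rewrite -iter_nsum_sum iterSr; congr (iter _ _ _); apply/funext => z.
  rewrite nsum_neighbours -!natr_sum; congr (_%:R).
  have cE (a b : vertex G) : (\sum_(e <- out_edges a) (b == tgt e) =
      size [seq e <- out_edges a | tgt e == b])%N.
    rewrite size_filter -sum1_count [RHS]big_mkcond; apply: eq_bigr => e _.
    by rewrite eq_sym; case: eqP.
  rewrite cE (eq_bigr (fun e => (x == tgt e) : nat)); last by move=> e _; rewrite eq_sym.
  (* Reversal is a bijection between the edges from [z] to [x] and those from [x] to [z]. *)
  rewrite cE -(size_map (@flip G)); apply: perm_size; apply: uniq_perm.
  - rewrite map_inj_uniq ?filter_uniq ?(out_edges_uniq) //.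
    exact: can_inj (@flipK G).
  - by rewrite filter_uniq ?out_edges_uniq.
  move=> e; apply/mapP/idP => [[f]|].
    rewrite !mem_filter !(mem_out_edges Greg) => /andP[/eqP fx /eqP fz] ->.
    by rewrite {1}/tgt flipK fz -fx !eqxx.
  rewrite mem_filter (mem_out_edges Greg) => /andP[/eqP ez /eqP ex].
  exists (flip e); last by rewrite flipK.
  by rewrite mem_filter (mem_out_edges Greg) /tgt flipK ex -ez !eqxx.
rewrite exchange_big /= exprS.
apply: (@le_trans _ _ (\sum_(e <- out_edges x) d%:R ^+ i)).
  by apply: ler_sum => e _; exact: IH.
by rewrite big_const_seq count_predT (size_out_edges Greg) iter_addr addr0 mulr_natl.
Qed.

(** The mean has total mass at most one, and by telescoping its average over the neighbours falls
    short of it by at most [1/m]; this is [nearly_harmonic_small] with [eta = 1/m]. *)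
Lemma cesaro_delta_small x n m z : (0 < m)%N ->
  m%:R^-1 * \sum_(1 <= i < m.+1) d%:R ^- i * iter i grA (fun y => (y == x)%:R) z
  <= n.+1%:R^-1 + (2 * d%:R) ^+ n * m%:R^-1.
Proof.
move=> m0; set D := fun y => _.
have dn0 i : 0 < d%:R ^+ i :> R by rewrite exprn_gt0 // ltr0n.
have m0' : 0 < m%:R :> R by rewrite ltr0n.
have it0 i y : 0 <= iter i grA D y by apply: iter_nsum_ge0 => w; exact: ler0n.
have it1 i y : d%:R ^- i * iter i grA D y <= 1.
  by rewrite ler_pdivrMl // mulr1; have := iter_delta_mass i x (l := [:: y]) isT; rewrite big_seq1.
pose g y := m%:R^-1 * \sum_(1 <= i < m.+1) d%:R ^- i * iter i grA D y.
apply: (@nearly_harmonic_small g); first by rewrite invr_gt0.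
  move=> l ul; rewrite -mulr_sumr ler_pdivrMl // mulr1 exchange_big /=.
  apply: (@le_trans _ _ (\sum_(1 <= i < m.+1) 1)); last by rewrite big_const_nat iter_addr addr0 subn1.
  by apply: ler_sum => i _; rewrite -mulr_sumr ler_pdivrMl // mulr1 iter_delta_mass.
move=> y.
have -> : grA g y = m%:R^-1 * (d%:R * \sum_(1 <= i < m.+1) d%:R ^- i.+1 * iter i.+1 grA D y).
  rewrite /g nsumZ; congr (_ * _); rewrite /nsum exchange_big mulr_sumr.
  apply: eq_bigr => i _; rewrite -mulr_sumr exprS invfM !mulrA mulfV ?mul1r //.
  by rewrite pnatr_eq0 -lt0n.
rewrite mulrCA ler_pM2l ?ltr0n // /g -{2}[m%:R^-1]mulr1 -mulrBr ler_pM2l ?invr_gt0 //.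
have := @telescope_sumr R 1 m.+1 (fun i => d%:R ^- i * iter i grA D y) (ltn0Sn m).
rewrite sumrB => tel; have := it1 1%N y.
have : 0 <= d%:R ^- m.+1 * iter m.+1 grA D y by rewrite mulr_ge0 // invr_ge0 ltW.
by lra.
Qed.
End MaximumPrinciple.

(** * Cycles in graphs of degree at most two *)

Lemma walk_target_mem x p y : walk x p y -> y \in x :: map (@tgt G) p.
Proof.
elim: p x => [|e p IH] x /=; first by move=> ->; rewrite mem_head.
by case=> _ /IH yp; rewrite inE yp orbT.
Qed.

Lemma star_pair (d2 : (d <= 2)%N) a b f :
  src a = src b -> b != a -> src f = src a -> f = a \/ f = b.
Proof.
move=> ab; rewrite eq_sym => nab fa; apply: contrapT => nf.
have /uniq_leq_size : uniq [:: f; a; b].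
  rewrite /= !inE nab negb_or !andbT; apply/andP.
  by split; apply/eqP => ff; apply: nf; [left | right].
have sub : {subset [:: f; a; b] <= out_edges (src a)}.
  by move=> e; rewrite (mem_out_edges Greg) !inE => /or3P[] /eqP ->; apply/eqP.
by move=> /(_ _ sub); rewrite (size_out_edges Greg) /=; lia.
Qed.

(** With at most two edges at each vertex, those at a vertex of the walk are the one leaving it and
    the reversal of the one entering it. All of them end on the walk, whose vertices then form a
    finite set without exit, contrary to [exit_edge]. *)
Lemma no_closed_walk (d2 : (d <= 2)%N) x y a b p :
  src a = x -> walk x p y -> src b = y -> nonbacktracking (flip a :: rcons p b) ->
  tgt a \in x :: map (@tgt G) p -> tgt b \in x :: map (@tgt G) p -> False.
Proof.
move=> ax wp yb nb ta tb.
have edges : forall f, src f \in x :: map (@tgt G) p ->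
    f \in a :: b :: p ++ map (@flip G) p.
  elim: p x a ax wp nb {ta tb} => [|e p IH] x a ax /=.
    move=> xy; rewrite flipK andbT => nba f; rewrite mem_seq1 => /eqP fx.
    have axb : src a = src b by rewrite ax yb.
    by have [->|->] := star_pair d2 axb nba (etrans fx (esym ax)); rewrite !inE eqxx ?orbT.
  case=> ex wp; rewrite flipK => /andP[ea nb] f; rewrite inE => /orP[/eqP fx|ft].
    have axe : src a = src e by rewrite ax ex.
    by have [->|->] := star_pair d2 axe ea (etrans fx (esym ax)); rewrite !inE eqxx ?orbT.
  have nb' : nonbacktracking (flip (flip e) :: rcons p b) by rewrite flipK.
  have := IH (tgt e) (flip e) erefl wp nb' f ft.
  rewrite !inE !mem_cat !inE => /or3P[->|->|/orP[->|->]]; by rewrite ?orbT.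
have srcs : {subset map (@src G) p <= x :: map (@tgt G) p}.
  elim: p x {ax nb ta tb edges} wp => [//|e p IH] x /= [ex wp] z.
  rewrite inE => /orP[/eqP ->|/(IH _ wp) zp]; first by rewrite ex mem_head.
  by rewrite inE zp orbT.
have [e [el]] := exit_edge (mem_head x (map (@tgt G) p)).
apply/negP; rewrite negbK; have := edges _ el; rewrite !inE mem_cat.
case/or4P => [/eqP -> //|/eqP -> //|ep|/mapP[f fp ->]]; first by rewrite map_f ?orbT.
by rewrite /tgt flipK; have := srcs _ (map_f _ fp); rewrite inE.
Qed.

(** The first and last edges of the cycle must be reverse to each other, for otherwise the cycle
    would exhaust the graph. Stripping both leaves a shorter cycle, and the descent ends at an edge
    equal to its own reversal. *)
Lemma cycle_half_loop (d2 : (d <= 2)%N) k x : (0 < k)%N -> cycle_at x k ->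
  exists h p, [/\ flip h = h, (size p <= k)%N & walk (src h) p x].
Proof.
elim/ltn_ind: k x => k IH x k0 [p [pk wp nb]].
case: p pk wp nb => [|e p] pk wp nb; first by rewrite -pk in k0.
have [ex wp'] := wp.
case/lastP: p pk wp nb wp' => [|p f] pk wp nb wp'.
  have [ee|ee] := eqVneq e (flip e); first by exists e, [::]; rewrite -ee.
  case: (@no_closed_walk d2 x x (flip e) e [::]) => //=.
  - by rewrite flipK ee.
  - by rewrite /tgt flipK ex mem_seq1.
  - by rewrite (_ : tgt e = x) ?mem_seq1.
have [y [wp1 [fy fx]]] : exists y, walk (tgt e) p y /\ walk y [:: f] x.
  by apply: walk_cat_inv; rewrite cats1.
have [ef|ef] := eqVneq e (flip f); last first.
  case: (@no_closed_walk d2 x x (flip f) e (e :: rcons p f)) => //.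
  - rewrite flipK /nonbacktracking /= ef /= rcons_path last_rcons ef andbT.
    exact: nb.
  - have yp : y \in tgt e :: map (@tgt G) p by exact: walk_target_mem wp1.
    rewrite {1}/tgt flipK fy inE /= map_rcons -rcons_cons mem_rcons inE yp.
    by rewrite !orbT.
  - by rewrite inE /= mem_head orbT.
have ty : y = tgt e by rewrite ef /tgt flipK.
rewrite ty in wp1.
have np : nonbacktracking p.
  have /path_sorted : path (fun e f => f != flip e) e (rcons p f) := nb.
  by case: (p) => //= g q; rewrite rcons_path => /andP[].
case: p {wp wp'} pk nb wp1 np => [|g p] pk nb wp1 np.
  by move: nb; rewrite /nonbacktracking /= ef flipK eqxx.
have pk' : (size (g :: p)).+2 = k by rewrite -pk /= size_rcons.
have lt_pk : (size (g :: p) < k)%N by rewrite -pk'.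
have ct : cycle_at (tgt e) (size (g :: p)) by exists (g :: p).
have [h [q [hh qs wq]]] := IH _ lt_pk (tgt e) isT ct.
exists h, (rcons q (flip e)); split=> //; first by rewrite size_rcons -pk'; apply: leqW.
rewrite -cats1; apply: walk_cat wq _; split=> //=.
by rewrite /tgt flipK.
Qed.

(** Two distinct half-loops would be the ends of a finite path exhausting the graph: backtracks are
    removed from a walk between them until [no_closed_walk] applies. *)
Lemma half_loop_unique (d2 : (d <= 2)%N) (h h' : edge G) :
  flip h = h -> flip h' = h' -> h = h'.
Proof.
move=> hh hh'; apply: contrapT => /eqP nh.
have [p] := Gcon (src h) (src h').
have [n] := ubnP (size p); elim: n p => // n IH p pn wp.
have th : tgt h = src h by rewrite /tgt hh.
have th' : tgt h' = src h' by rewrite /tgt hh'.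
have [nb|/backtrackP[u [f [w]]]] := boolP (nonbacktracking (h :: rcons p h')).
  apply: (@no_closed_walk d2 (src h) (src h') h h' p) => //; rewrite ?hh ?th ?mem_head //.
  by rewrite th'; exact: walk_target_mem wp.
case: u => [|g u] /=; [case=> <- | case=> _].
  case: p wp pn => [|g p] wp pn /= [].
    by move=> hh'e; rewrite hh'e hh eqxx in nh.
  move=> gh _; case: wp => _; rewrite gh hh th; apply: IH.
  by rewrite -ltnS.
case/lastP: w => [|w g'].
  rewrite (_ : u ++ _ = rcons (rcons u f) (flip f)); last by rewrite -!cats1 -catA.
  move/rcons_inj => [pE h'f].
  have fh' : f = h' by rewrite -hh' h'f flipK.
  move: wp pn; rewrite pE fh' -cats1 => /walk_cat_inv[z [wu [hz _]]].
  rewrite -hz in wu; rewrite size_cat addn1 ltnS => un; exact: IH wu.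
rewrite (_ : u ++ _ = rcons (u ++ f :: flip f :: w) g'); last by rewrite -!cats1 -catA.
move/rcons_inj => [pE _].
move: wp pn; rewrite pE => /walk_cat_inv[z [wu /= [fz [_ ww]]]] pn.
apply: (IH (u ++ w)); last by apply: walk_cat wu _; rewrite -fz; move: ww; rewrite /tgt flipK.
by move: pn; rewrite !size_cat /=; lia.
Qed.

Lemma cycle_at_finite (d2 : (d <= 2)%N) k : (0 < k)%N ->
  exists l, forall x, cycle_at x k -> x \in l.
Proof.
move=> k0; have [[h hh]|nh] := pselect (exists h : edge G, flip h = h).
  exists (reach k (src h)) => x /(cycle_half_loop d2 k0)[h' [p [hh' pk wp]]].
  by apply: mem_reach pk _; rewrite (half_loop_unique d2 hh hh').
exists [::] => x /(cycle_half_loop d2 k0)[h' [p [hh' _ _]]].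
by case: nh; exists h'.
Qed.

End Infinite.

(** * The law of the random walk *)

Section Law.
Variables (R : realType) (G : multigraph) (d : nat).
Hypothesis Greg : regular_graph G d.
Hypothesis Gcon : connected_graph G.
Hypothesis d_gt0 : (0 < d)%N.
Variables (disp : measure_display) (Omega : measurableType disp).
Variables (P : probability Omega R) (o : vertex G) (X : nat -> Omega -> vertex G).
Hypothesis X_walk : standard_random_walk d o P X.
Notation grA := (nsum (R := R) (neighbours (G := G))).

Let pr (B : set Omega) : R := fine (P B).

Let prE B : measurable B -> P B = (pr B)%:E.
Proof. by move=> mB; rewrite /pr fineK // fin_num_measure. Qed.

Let pr_ge0 B : 0 <= pr B.
Proof. by rewrite /pr fine_ge0. Qed.

Let prDI A B : measurable A -> measurable B -> pr A = pr (A `\` B) + pr (A `&` B).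
Proof.
move=> mA mB; apply: EFin_inj; rewrite EFinD -!prE //; last 2 first.
- exact: measurableI.
- exact: measurableD.
exact: measureDI.
Qed.

Let pr_le A B : measurable A -> measurable B -> A `<=` B -> pr A <= pr B.
Proof.
move=> mA mB AB; rewrite -lee_fin -!prE //.
by apply: le_measure => //; apply: mem_set.
Qed.

Let mX i v : measurable [set w | X i w = v].
Proof. by case: X_walk. Qed.

Let mXseq i (l : seq (vertex G)) : measurable [set w | X i w \in l].
Proof.
elim: l => [|x l IH]; first by rewrite (_ : mkset _ = set0) //; apply/seteqP; split.
rewrite (_ : mkset _ = [set w | X i w = x] `|` [set w | X i w \in l]).
  exact: measurableU.
apply/seteqP; split=> w /=; rewrite in_cons.
  by case/orP => [/eqP|]; [left | right].
by case=> [->|->]; rewrite ?eqxx ?orbT.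
Qed.

(** By connectedness [X i] always lies in some [reach n o], so the event is a countable union of
    events about finite lists. *)
Let mXset i (K : set (vertex G)) : measurable [set w | K (X i w)].
Proof.
rewrite (_ : mkset _ = \bigcup_n [set w | X i w \in [seq x <- reach n o | `[<K x>]]]).
  by apply: bigcupT_measurable => n; exact: mXseq.
apply/seteqP; split=> w /= => [Kw|[n _] /=].
  have [p wp] := Gcon o (X i w); exists (size p) => //=.
  by rewrite mem_filter (mem_reach Greg (leqnn _) wp) andbT; apply/asboolP.
by rewrite mem_filter => /andP[/asboolP].
Qed.

Let pr_seq i B (l : seq (vertex G)) : measurable B -> uniq l ->
  pr (B `&` [set w | X i w \in l]) = \sum_(y <- l) pr (B `&` [set w | X i w = y]).
Proof.
move=> mB; elim: l => [_|x l IH /= /andP[xl ul]].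
  rewrite big_nil (_ : _ `&` _ = set0) ?/pr ?measure0 //.
  by apply/seteqP; split=> // w [].
have mBl : measurable (B `&` [set w | X i w \in x :: l]) by exact: measurableI.
rewrite big_cons -IH // (prDI mBl (mX i x)) addrC; congr (pr _ + pr _).
  apply/seteqP; split=> w /= [] => [[Bw _] wx //|Bw wx].
  by rewrite wx mem_head.
apply/seteqP; split=> w /= [] => [[Bw wl] /eqP wx|Bw wl].
  by move: wl; rewrite in_cons (negbTE wx).
split; first by rewrite in_cons wl orbT.
by move=> wx; rewrite -wx wl in xl.
Qed.

Let cyl n (t : nat -> vertex G) : set Omega :=
  [set w | forall i, (i <= n)%N -> X i w = t i].

Let cylS n t : cyl n.+1 t = cyl n t `&` [set w | X n.+1 w = t n.+1].
Proof.
apply/seteqP; split=> w /= => [wt|[wt wn] i].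
  by split=> [i /leqW /wt|]; last exact: wt.
by rewrite leq_eqVlt ltnS => /orP[/eqP -> //|/wt].
Qed.

Let mcyl n t : measurable (cyl n t).
Proof.
elim: n => [|n IH]; last by rewrite cylS; exact: measurableI.
rewrite (_ : cyl 0 t = [set w | X 0%N w = t 0%N]) //; apply/seteqP; split=> w /=.
  by apply.
by move=> w0 i; rewrite leqn0 => /eqP ->.
Qed.

Lemma step_probE (x y : vertex G) :
  step_prob R d x y = d%:R^-1 * \sum_(e <- out_edges x) (tgt e == y)%:R.
Proof.
rewrite /step_prob (_ : mkset _ = star x `&` [set e | tgt e = y]) //.
rewrite fsbig_mkcondr fsbig_finite; last exact: finite_star.
rewrite mulr_sumr; apply: eq_bigr => e _.
case: eqP => ey; first by rewrite mem_set // mulr1.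
by rewrite memNset // mulr0.
Qed.

Lemma sum_step_prob (x : vertex G) (F : vertex G -> R) :
  \sum_(y <- undup (neighbours x)) step_prob R d x y * F y = d%:R^-1 * grA F x.
Proof.
under eq_bigr do rewrite step_probE -mulrA mulr_suml.
rewrite -mulr_sumr exchange_big nsum_neighbours; congr (_ * _).
apply: eq_big_seq => e ex /=.
have ey : tgt e \in undup (neighbours x) by rewrite mem_undup map_f.
rewrite (bigD1_seq (tgt e)) ?undup_uniq //= eqxx mul1r big1 ?addr0 // => y.
by rewrite eq_sym => /negbTE ->; rewrite mul0r.
Qed.

Let pr_step n t y :
  pr (cyl n t `&` [set w | X n.+1 w = y]) = pr (cyl n t) * step_prob R d (t n) y.
Proof.
case: X_walk => _ _ /(_ n (fun i => if (i <= n)%N then t i else y)).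
rewrite leqnn ltnn -/(cyl n.+1 _) -/(cyl n _) cylS ltnn.
have -> : cyl n (fun i => if (i <= n)%N then t i else y) = cyl n t.
  by apply/seteqP; split=> w /= wt i ni; have := wt i ni; rewrite ni.
by move=> PE; apply: EFin_inj; rewrite EFinM -!prE //; exact: measurableI.
Qed.

(** Conditioning on the next position: the Markov property lengthens the cylinder by one step, and
    [sum_step_prob] recombines the neighbours into one neighbour sum. *)
Let law_le m n t (K : set (vertex G)) :
  pr (cyl n t `&` [set w | K (X (n + m)%N w)])
  <= pr (cyl n t) * (d%:R ^- m * iter m grA \1_K (t n)).
Proof.
elim: m n t => [|m IH] n t.
  rewrite addn0 expr0 invr1 mul1r /= indicE; case: (boolP (_ \in _)) => [_|/negP tK].
    by rewrite mulr1; apply: pr_le => //; apply: measurableI.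
  rewrite mulr0 (_ : _ `&` _ = set0) ?/pr ?measure0 //.
  apply/seteqP; split=> // w [/= wt Kw]; apply: tK; apply: mem_set.
  by rewrite -(wt n (leqnn n)).
set l := undup (neighbours (t n)); set B := _ `&` _.
have mB : measurable B by exact: measurableI.
have ul : uniq l by exact: undup_uniq.
(* The step probabilities sum to one, so on this cylinder [X n.+1] almost surely lies among the
   neighbours of [t n]. *)
have cl : pr (cyl n t `&` [set w | X n.+1 w \in l]) = pr (cyl n t).
  rewrite pr_seq //; under eq_bigr do rewrite pr_step -[step_prob _ _ _ _]mulr1.
  rewrite -mulr_sumr (sum_step_prob _ (fun=> 1)) nsum_neighbours.
  rewrite big_const_seq count_predT (size_out_edges Greg) iter_addr addr0.
  by rewrite mulVf ?mulr1 // pnatr_eq0 -lt0n.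
have B0 : pr (B `\` [set w | X n.+1 w \in l]) = 0.
  apply/eqP; rewrite eq_le pr_ge0 andbT.
  have -> : 0 = pr (cyl n t `\` [set w | X n.+1 w \in l]).
    by have := prDI (mcyl n t) (mXseq n.+1 l); rewrite cl; lra.
  apply: pr_le; [exact: measurableD | exact: measurableD |].
  by move=> w [[]].
rewrite (prDI mB (mXseq n.+1 l)) B0 add0r pr_seq //.
have -> : pr (cyl n t) * (d%:R ^- m.+1 * iter m.+1 grA \1_K (t n))
        = \sum_(y <- l) pr (cyl n t) * step_prob R d (t n) y *
                         (d%:R ^- m * iter m grA \1_K y).
  under eq_bigr do rewrite -mulrA.
  rewrite -mulr_sumr sum_step_prob (nsumZ _ (d%:R ^- m)) exprS invfM.
  by rewrite -mulrA.
apply: ler_sum => y _; pose ty i := if (i <= n)%N then t i else y.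
have cy : cyl n.+1 ty = cyl n t `&` [set w | X n.+1 w = y].
  rewrite cylS /ty ltnn; congr (_ `&` _).
  by apply/seteqP; split=> w /= wt i ni; have := wt i ni; rewrite /ty ni.
rewrite -pr_step -cy.
have := IH n.+1 ty; rewrite {3}/ty ltnn addSnnS; apply: le_trans.
apply: pr_le; rewrite ?cy; [by apply: measurableI | |].
  by apply: measurableI => //; exact: measurableI.
by move=> w [[/= wt Kw] wy].
Qed.

Lemma expectation_cycle_le i k :
  (0 <= 'E_P[fun w => cycle_indicator R k (X i w)] <=
   (d%:R ^- i * iter i grA (cycle_indicator R k) o)%:E)%E.
Proof.
pose K := [set x : vertex G | cycle_at x k].
have -> : (fun w => cycle_indicator R k (X i w)) = \1_[set w | K (X i w)].
  by apply/funext => w; rewrite /cycle_indicator !indicE; congr (_%:R);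
    apply/idP/idP => /set_mem ?; apply/mem_set.
rewrite expectation_indic // measure_ge0 /= prE // lee_fin.
have [_ P0 _] := X_walk.
(* The cylinder at time zero only looks at [t 0], and it has probability one. *)
pose t := fun _ : nat => o.
have c0 : cyl 0 t = [set w | X 0%N w = o].
  apply/seteqP; split=> w /=; first by apply.
  by move=> w0 j; rewrite leqn0 => /eqP ->.
have p0 : pr (cyl 0 t) = 1 by rewrite c0 /pr P0.
have := law_le i 0 t K; rewrite p0 mul1r add0n; apply: le_trans.
rewrite (prDI (mXset i K) (mcyl 0 t)) setIC -[leRHS]add0r lerD2r.
have := prDI measurableT (mcyl 0 t); rewrite setTI p0.
have -> : pr setT = 1 by rewrite /pr probability_setT.
have : pr ([set w | K (X i w)] `\` cyl 0 t) <= pr (setT `\` cyl 0 t).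
  by apply: pr_le; [exact: measurableD | exact: measurableD | move=> w []].
by lra.
Qed.

End Law.

(** * Convergence of Cesaro means, and the conclusion *)

Lemma cesaro_ereal_cvg0 (R : realType) (u : nat -> \bar R) (v : nat -> R) :
  (forall i, (0 <= u i <= (v i)%:E)%E) ->
  (forall e, 0 < e -> exists C, forall n, (0 < n)%N ->
     n%:R^-1 * \sum_(1 <= i < n.+1) v i <= e + C * n%:R^-1) ->
  ((fun n : nat => (n%:R^-1)%:E * \sum_(1 <= i < n.+1) u i)%E
   @ \oo --> (0 : \bar R)%E).
Proof.
move=> uv vb; pose b n : R := n%:R^-1 * \sum_(1 <= i < n.+1) v i.
have v0 i : 0 <= v i by case/andP: (uv i) => u0 /(le_trans u0); rewrite lee_fin.
have b0 n : 0 <= b n by rewrite mulr_ge0 ?invr_ge0 ?sumr_ge0.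
have bcvg : b n @[n --> \oo] --> 0.
  apply/cvgrPdist_le => e e0.
  (* The constant [C] may depend on [e], since [n] is sent to infinity only afterwards. *)
  have [C bC] := vb _ (divr_gt0 e0 (ltr0Sn R 1)).
  near=> n; rewrite sub0r normrN ger0_norm //.
  have n0 : (0 < n)%N by near: n; exact: nbhs_infty_gt.
  apply: le_trans (bC n n0) _.
  have : C * n%:R^-1 <= e / 2; last by lra.
  rewrite ler_pdivrMr ?ltr0n // -ler_pdivrMl ?divr_gt0 //.
  by near: n; exact: nbhs_infty_ger.
apply: (@squeeze_cvge _ _ _ _ (cst 0%E) _ (EFin \o b)); last 2 first.
- exact: cvg_cst.
- by apply: cvg_EFin; [exact: nearW | exact: bcvg].
apply: nearW => n /=; apply/andP; split.
  apply: mule_ge0; first by rewrite lee_fin invr_ge0.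
  by apply: sume_ge0 => i _; case/andP: (uv i).
rewrite /b EFinM -sumEFin; apply: lee_wpmul2l; first by rewrite lee_fin invr_ge0.
by apply: lee_sum => i _; case/andP: (uv i).
Unshelve. all: by end_near. Qed.

Theorem theorem4p1 (R : realType) (d : nat) (G : multigraph) (o : vertex G)
    (G_infinite : infinite_set [set: vertex G])
    (G_connected : connected_graph G)
    (G_regular : regular_graph G d)
    (G_ramanujan : ramanujan R d G)
    (disp : measure_display) (Omega : measurableType disp)
    (P : probability Omega R) (X : nat -> Omega -> vertex G)
    (X_walk : standard_random_walk d o P X)
    (k : nat) (k_ge1 : (1 <= k)%N) :
  ((fun n : nat =>
      (n%:R^-1)%:E *
      \sum_(1 <= i < n.+1) 'E_P[fun w => cycle_indicator R k (X i w)])%E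
   @ \oo --> (0 : \bar R)%E).
Proof.
have d0 := regular_degree_gt0 G_infinite G_connected G_regular.
apply: cesaro_ereal_cvg0.
  by move=> i; exact: (expectation_cycle_le G_regular G_connected d0 X_walk).
pose A := nsum (R := R) (neighbours (G := G)).
rewrite -/A => e e0; have [d3|d2] := ltnP 2 d.
  have super a : 2 * Num.sqrt d.-1%:R < a ->
      exists h : vertex G -> R, (forall x, 0 < h x) /\ forall x, A h x <= a * h x.
    move=> sa; have s0 : 0 < Num.sqrt d.-1%:R :> R by rewrite sqrtr_gt0 ltr0n; lia.
    apply: (supersolution G_regular G_connected d0 o
      (r := 2 * Num.sqrt d.-1%:R / d%:R)).
    - by rewrite divr_gt0 ?mulr_gt0 // ltr0n.
    (* The Ramanujan hypothesis replaces the spectral radius by that of the tree, which is at most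
       [2 sqrt (d - 1) / d]. *)
    - by rewrite G_ramanujan; exact: spectral_radius_tree.
    - by rewrite mulrC divfK // pnatr_eq0 -lt0n.
  have [C HC] := cycle_sum_bounded G_regular d3 o k_ge1 super.
  exists (2 * C) => n n0; rewrite mulrC.
  have n0' : 0 <= n%:R^-1 :> R by rewrite invr_ge0.
  apply: (@le_trans _ _ (2 * C * n%:R^-1)); last by rewrite lerDr ltW.
  apply: ler_wpM2r => //.
  have c0 (x : vertex G) : 0 <= cycle_indicator R k x by rewrite /cycle_indicator indicE.
  (* The terms of index [0] to [n] are bounded together, uniformly in [n]; the term of index [0],
     absent from the Cesaro sum, is nonnegative. *)
  have := green_bound G_regular o n.+1 d3 c0; rewrite -/A => gb.
  apply: (@le_trans _ _ (\sum_(i < n.+1) d%:R ^- i * iter i A (cycle_indicator R k) o)).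
    rewrite -(big_mkord xpredT (fun i => d%:R ^- i * iter i A (cycle_indicator R k) o)).
    rewrite [leRHS]big_ltn // lerDr mulr_ge0 ?invr_ge0 ?exprn_ge0 //.
  by apply: le_trans gb _; rewrite ler_pM2l.
have [l Hl] := cycle_at_finite G_infinite G_connected G_regular d2 k_ge1.
(* This choice makes [size l / N.+1] at most [e]; the other term of [cesaro_delta_small], summed
   over [l], gives the constant over [n]. *)
pose N := Num.bound ((size l)%:R / e); pose D (x y : vertex G) : R := (y == x)%:R.
exists ((size l)%:R * (2 * d%:R) ^+ N) => n n0.
have d0' : 0 < d%:R :> R by rewrite ltr0n.
have v_le i : d%:R ^- i * iter i A (cycle_indicator R k) o
    <= \sum_(x <- l) d%:R ^- i * iter i A (D x) o.
  rewrite -mulr_sumr ler_wpM2l ?invr_ge0 ?exprn_ge0 //.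
  apply: (@le_trans _ _ (iter i A (fun y => \sum_(x <- l) D x y) o)); last first.
    by rewrite iter_nsum_sum.
  apply: ler_iter_nsum => y; rewrite /cycle_indicator indicE.
  case: (boolP (_ \in _)) => [/set_mem /Hl yl|_]; last by rewrite sumr_ge0 // => x _; exact: ler0n.
  rewrite (perm_big _ (perm_to_rem yl)) big_cons /D eqxx lerDl.
  by rewrite sumr_ge0 // => x _; exact: ler0n.
apply: (@le_trans _ _ (\sum_(x <- l)
    (n%:R^-1 * \sum_(1 <= i < n.+1) d%:R ^- i * iter i A (D x) o))).
  rewrite -mulr_sumr ler_wpM2l ?invr_ge0 // exchange_big /=.
  by apply: ler_sum => i _; exact: v_le.
apply: (@le_trans _ _ (\sum_(x <- l) (N.+1%:R^-1 + (2 * d%:R) ^+ N * n%:R^-1))).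
  by apply: ler_sum => x _; exact: cesaro_delta_small.
rewrite big_const_seq count_predT iter_addr addr0 -[X in X <= _]mulr_natl mulrDr mulrA lerD2r.
rewrite ler_pdivrMr ?ltr0n // mulrC -ler_pdivrMr //.
have : (size l)%:R / e < N%:R by apply: archi_boundP; rewrite divr_ge0 // ltW.
by move=> /ltW/le_trans; apply; rewrite ler_nat.
Qed.
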